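(* Let $D$ be an integral domain, let $\star$ be a semistar operation on $D$, and let $n\ge 1$ be an integer. Suppose that $D$ is a $\widetilde{\star}$-quasi-Prüfer domain (e.g., if $D$ is a P$\star$MD). Then $$\star[X_1,\cdots,X_n]\text{-}\dim(D[X_1,\cdots,X_n])=\star[X_1,\cdots,X_n]\text{-}\dim_v(D[X_1,\cdots,X_n])=n+\widetilde{\star}\text{-}\dim(D).$$
   Context: For a domain $D$ with quotient field $K$, $\overline{\mathcal F}(D)$ is the set of nonzero $D$-submodules of $K$ and $f(D)$ the set of nonzero finitely generated $D$-submodules of $K$. A semistar operation on $D$ is a map $\star:\overline{\mathcal F}(D)\to\overline{\mathcal F}(D)$, $E\mapsto E^\star$, such that for all $0\ne x\in K$ and $E,F\in\overline{\mathcal F}(D)$: $(xE)^\star=xE^\star$; $E\subseteq F$ implies $E^\star\subseteq F^\star$; $E\subseteq E^\star=(E^\star)^\star$. Define $E^{\star_f}:=\bigcup\{F^\star\mid F\in f(D),F\subseteq E\}$. A nonzero ideal $I$ of $D$ is a quasi-$\star$-ideal if $I^\star\cap D=I$; $\operatorname{QSpec}^\star(D)$ is the set of prime quasi-$\star$-ideals (quasi-$\star$-primes); $\operatorname{QMax}^{\star}(D)$ is the set of maximal elements of the set of proper quasi-$\star$-ideals (they are prime). $\widetilde\star$ is the semistar operation $E^{\widetilde\star}:=\bigcap\{ED_P\mid P\in\operatorname{QMax}^{\star_f}(D)\}$ (equal to $K$ if $\operatorname{QMax}^{\star_f}(D)=\emptyset$). $D$ is $\star$-quasi-Prüfer if for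 every prime ideal $Q$ of $D[X]$ with $Q\subseteq P[X]$ for some $P\in\operatorname{QSpec}^\star(D)$, one has $Q=(Q\cap D)[X]$. $D$ is a P$\star$MD if $(II^{-1})^{\star_f}=D^\star$ for every $I\in f(D)$, where $I^{-1}=\{x\in K\mid xI\subseteq D\}$. $\star\text{-}\dim(D)$ is the supremum of the integers $n$ such that there is a chain $(0)\subsetneq P_1\subsetneq\cdots\subsetneq P_n$ with each $P_i$ a quasi-$\star$-prime of $D$; it is $0$ if there are no quasi-$\star$-primes. A valuation overring $V$ of $D$, i.e. a valuation domain with $D\subseteq V\subseteq K$ ($V=K$ allowed, of dimension $0$), is a $\star$-valuation overring if $F^\star\subseteq FV$ for each $F\in f(D)$. $\star\text{-}\dim_v(D)=n$ means every $\star$-valuation overring of $D$ has dimension at most $n$ and some $\star$-valuation overring has dimension $n$; if no such integer exists, $\star\text{-}\dim_v(D)=\infty$. Usual conventions for $\infty$ apply. Let $X,Y$ be indeterminates, $D_1:=D[X]$, $K_1:=K(X)$, $\Theta_1^{\star}:=\{Q\in\operatorname{Spec}(D_1)\mid Q\cap D=(0)\text{ or }(Q\cap D)^{\star_f}\subsetneq D^{\star}\}$, $\mathfrak S_1^\star:=D_1[Y]\setminus\bigcup\{Q[Y]\mid Q\in\Theta_1^\star\}$. The semistar operation $\star[X]$ on $D[X]$ is defined by $E^{\star[X]}:=E[Y]_{\mathfrak S_1^\star}\cap K_1$ for $E\in\overline{\mathcal F}(D_1)$. For $r\ge2$, $\star[X_1,\cdots,X_r]:=(\star[X_1,\cdots,X_{r-1}])[X_r]$,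 a semistar operation on $D[X_1,\cdots,X_r]$. *)

(* Defs.v *)
(* Subsets of a ring are classical sets over MathComp structures.  For
   [D : idomainType], the quotient field is [{fraction D}], and [D] sits in it
   as [range (@tofrac D)]. *)
From HB Require Import structures.
From mathcomp Require Import all_boot all_order all_algebra.
From mathcomp Require Import boolp classical_sets constructive_ereal.

Set Implicit Arguments.
Unset Strict Implicit.
Unset Printing Implicit Defensive.

Import Order.TTheory GRing.Theory Num.Theory.
Local Open Scope classical_set_scope.
Local Open Scope ring_scope.

Local Notation tofrac := FracField.tofrac.

Section Subsets.
Variable R : comNzRingType.
Implicit Types A E F I P : set R.

Definition nonzero_set E : Prop := exists2 x, E x & x != 0.

Definition submodule A E : Prop :=
  E 0 /\ forall a x y, A a -> E x -> E y -> E (a * x + y).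

Definition generated A (s : seq R) : set R :=
  [set x | exists2 c : 'I_(size s) -> R,
     (forall i, A (c i)) & x = \sum_(i < size s) c i * s`_i].

Definition setmul E F : set R :=
  [set x | exists (m : nat) (e f : 'I_m -> R),
     [/\ forall i, E (e i), forall i, F (f i) & x = \sum_(i < m) e i * f i]].

(* Ideals of a subring A of R; the ideals of R itself are those of setT. *)
Definition ideal_of A I : Prop := I `<=` A /\ submodule A I.

Definition prime_ideal_of A P : Prop :=
  [/\ ideal_of A P, ~ P 1 &
      forall a b, A a -> A b -> P (a * b) -> P a \/ P b].

End Subsets.

(* Both dimensions take values in [\bar int], in order to include infinity. *)
Definition nat_bar (m : nat) : \bar int := (m%:Z)%:E.

Definition sup_nat (A : set nat) : \bar int :=
  supremum 0%E [set nat_bar m | m in A].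

Section Semistar.
Variable D : idomainType.
Local Notation K := {fraction D}.
Implicit Types (star : set K -> set K) (E F V : set K) (I P M Q : set D).

Definition base : set K := range (@tofrac D).
Definition emb I : set K := @tofrac D @` I.

Definition Fbar E : Prop := submodule base E /\ nonzero_set E.
Definition fgen E : Prop :=
  nonzero_set E /\ exists s : seq K, E = generated base s.

Definition scale (x : K) E : set K := [set x * y | y in E].

(* [star] is a total function on subsets of K; only its values on the nonzero
   D-submodules of K are constrained. *)
Record semistar star : Prop := Semistar {
  semistar_Fbar : forall E, Fbar E -> Fbar (star E);
  semistar_scale : forall x E, x != 0 -> Fbar E ->
    star (scale x E) = scale x (star E);
  semistar_mono : forall E F, Fbar E -> Fbar F -> E `<=` F ->
    star E `<=` star F;
  semistar_ext : forall E, Fbar E -> E `<=` star E;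
  semistar_idem : forall E, Fbar E -> star (star E) = star E
}.

Definition star_f star : set K -> set K :=
  fun E => \bigcup_(F in [set F | fgen F /\ F `<=` E]) star F.

Definition ideal I : Prop := ideal_of setT I.
Definition prime_ideal P : Prop := prime_ideal_of setT P.

Definition quasi_ideal star I : Prop :=
  [/\ ideal I, nonzero_set I & @tofrac D @^-1` (star (emb I)) = I].

Definition QSpec star : set (set D) :=
  [set P | prime_ideal P /\ quasi_ideal star P].

Definition proper_quasi_ideal star I : Prop := quasi_ideal star I /\ I <> setT.

Definition QMax star : set (set D) :=
  [set M | proper_quasi_ideal star M /\
     forall I, proper_quasi_ideal star I -> M `<=` I -> I = M].

Definition local_at P : set K :=
  [set x | exists a s : D, ~ P s /\ x = tofrac a / tofrac s].

Definition star_tilde star : set K -> set K :=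
  fun E => \bigcap_(P in QMax (star_f star)) setmul E (local_at P).

(* I[X], for I a subset of D. *)
Definition ext_poly (R : nzRingType) (I : set R) : set {poly R} :=
  [set p | forall i, I p`_i].

Definition contraction (Q : set {poly D}) : set D := polyC @^-1` Q.

Definition quasi_prufer star : Prop :=
  forall Q : set {poly D}, prime_ideal_of setT Q ->
    (exists2 P, QSpec star P & Q `<=` ext_poly P) ->
    Q = ext_poly (contraction Q).

Definition inv_frac E : set K := [set x | forall y, E y -> base (x * y)].

Definition PsMD star : Prop :=
  forall E, fgen E -> star_f star (setmul E (inv_frac E)) = star base.

Definition star_chain star (m : nat) : Prop :=
  exists P : nat -> set D, P 0%N = [set 0] /\
    forall i, (i < m)%N -> P i `<` P i.+1 /\ QSpec star (P i.+1).

Definition star_dim star : \bar int := sup_nat (star_chain star).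

Definition krull_chain V (m : nat) : Prop :=
  exists P : nat -> set K,
    (forall i, (i <= m)%N -> prime_ideal_of V (P i)) /\
    (forall i, (i < m)%N -> P i `<` P i.+1).

Definition krull_dim V : \bar int := sup_nat (krull_chain V).

Definition valuation_overring V : Prop :=
  [/\ GRing.subring_closed [in V], base `<=` V &
      forall x : K, x != 0 -> V x \/ V x^-1].

Definition star_valuation_overring star V : Prop :=
  valuation_overring V /\ forall F, fgen F -> star F `<=` setmul F V.

Definition is_star_dimv star (m : nat) : Prop :=
  (forall V, star_valuation_overring star V ->
     (krull_dim V <= nat_bar m)%E) /\
  exists2 V, star_valuation_overring star V & krull_dim V = nat_bar m.

(* At most one [m] satisfies [is_star_dimv star m]; the value is +oo if none
   does. *)
Definition star_dimv star : \bar int :=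
  xget +oo%E [set nat_bar m | m in is_star_dimv star].

Definition Theta star : set (set {poly D}) :=
  [set Q | prime_ideal_of setT Q /\
     (contraction Q = [set 0] \/
      star_f star (emb (contraction Q)) `<` star base)].

Definition Smult star : set {poly {poly D}} :=
  ~` \bigcup_(Q in Theta star) ext_poly Q.

(* The intersection of K(X) with the fractions g/s, g in E[Y], s in Smult,
   formed in the quotient field of K(X)[Y]. *)
Definition star_poly star :
    set {fraction {poly D}} -> set {fraction {poly D}} :=
  fun E : set {fraction {poly D}} => [set z | exists (g : {poly {fraction {poly D}}})
                           (s : {poly {poly D}}),
    [/\ ext_poly E g, Smult star s &
        tofrac z%:P =
        tofrac g /
        tofrac (map_poly (@tofrac {poly D}) s)]].

End Semistar.

(* D[X_1, ..., X_r] as D[X_1, ..., X_{r-1}][X_r]. *)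
Fixpoint poly_iter (D : idomainType) (r : nat) : idomainType :=
  if r is r'.+1 then {poly (poly_iter D r')} else D.

Fixpoint star_iter (D : idomainType) (star : set {fraction D} -> set {fraction D})
    (r : nat) : set {fraction poly_iter D r} -> set {fraction poly_iter D r} :=
  match r return set {fraction poly_iter D r} -> set {fraction poly_iter D r} with
  | 0 => star
  | r'.+1 => @star_poly (poly_iter D r') (@star_iter D star r')
  end.
Arguments star_iter {D} star r _.

(* Main.v *)
(* The primes [P] of [D] that are zero or satisfy [P^{star_f} <> D^star] are the
   zero ideal and the quasi-primes of [star_tilde].  Every prime not among them
   contains a finite set contained in none of them, and this makes the
   quasi-primes of [star[X]] the nonzero primes of [D[X]] that contract to one of
   them, and the [star[X]]-valuation overrings those centred on one of them.  By
   iteration, the primes and valuation overrings of [D[X_1, ..., X_n]] to be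
   considered are those lying over these primes of [D].

   A chain of [m] of these primes of [D] yields a chain of length [m + n] in
   [D[X_1, ..., X_n]], and each chain there lifts to a valuation overring.
   Conversely, contracting a chain of primes of a valuation ring from [K(X)] to
   [K] loses at most one step, and from [K] to a quasi-Pruefer [D] none:
   each [t] in [K] is a root of a polynomial with a coefficient outside [P]. *)
Require Import Defs.
From HB Require Import structures.
From mathcomp Require Import all_boot all_order all_algebra.
From mathcomp Require Import boolp classical_sets constructive_ereal.
From mathcomp Require Import ring zify.

Set Implicit Arguments.
Unset Strict Implicit.
Unset Printing Implicit Defensive.

Import Order.TTheory GRing.Theory Num.Theory.
Local Open Scope classical_set_scope.
Local Open Scope ring_scope.

(** All three quantities are compared by a cycle of implications on single chain lengths, which
    treats finite and infinite dimensions alike: a chain of length [m] in [D] gives one of length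
    [n + m] in the polynomial ring, that one gives a valuation overring with a chain of length
    [n + m], and its contraction to [K] leads back to a chain of length [m] in [D]. The obstacle is
    the iteration over the variables. It carries only [primes_of_finite_type], which survives
    adjoining a variable and already determines the quasi-primes and valuation overrings of
    [star_poly]; the semistar axioms are used over [D] alone. A step of the chain over [K(X)]
    disappears in [K] only when it produces a value independent of the values of [K]. Two such steps
    would give two algebraically independent elements, and [K(X)] has transcendence degree one over
    [K]. *)

Local Notation tofrac := FracField.tofrac.

(** * Subrings, modules and polynomial extensions of ideals *)

Section FiniteSums.
Variable R : comNzRingType.
Implicit Types (A E F I P V : set R).

Definition subring V : Prop :=
  [/\ V 1, forall x y, V x -> V y -> V (x - y) &
      forall x y, V x -> V y -> V (x * y)].

Lemma subringP V : GRing.subring_closed [in V] <-> subring V.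
Proof.
split=> [[h1 hB hM]|[h1 hB hM]].
- split; first by move: h1; rewrite in_setE.
  + by move=> x y Vx Vy; move: (hB x y); rewrite !in_setE; apply.
  + by move=> x y Vx Vy; move: (hM x y); rewrite !in_setE; apply.
- split; first by rewrite in_setE.
  + by move=> x y; rewrite !in_setE; apply: hB.
  + by move=> x y; rewrite !in_setE; apply: hM.
Qed.

Lemma subring0 V : subring V -> V 0.
Proof. by case=> h1 hB _; rewrite -(subrr 1); apply: hB. Qed.

Lemma subringN V x : subring V -> V x -> V (- x).
Proof. by move=> sV Vx; rewrite -sub0r; case: (sV) => _ + _; apply => //; apply: subring0. Qed.

Lemma subringD V x y : subring V -> V x -> V y -> V (x + y).
Proof.
move=> sV Vx Vy; rewrite -(opprK y); case: (sV) => _ + _; apply => //.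
exact: subringN.
Qed.

Lemma subringM V x y : subring V -> V x -> V y -> V (x * y).
Proof. by case=> _ _ hM; apply: hM. Qed.

Lemma subringX V x n : subring V -> V x -> V (x ^+ n).
Proof.
move=> sV Vx; elim: n => [|n IH]; first by rewrite expr0; case: sV.
by rewrite exprS; apply: subringM.
Qed.

Lemma submodD A E x y : A 1 -> submodule A E -> E x -> E y -> E (x + y).
Proof. by move=> A1 [_ h] Ex Ey; rewrite -[x]mul1r; apply: h. Qed.

Lemma submodM A E a x : submodule A E -> A a -> E x -> E (a * x).
Proof. by move=> [E0 h] Aa Ex; rewrite -[_ * _]addr0; apply: h. Qed.

Lemma submodN A E x : subring A -> submodule A E -> E x -> E (- x).
Proof.
move=> sA sE Ex; rewrite -mulN1r; apply: submodM sE _ Ex.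
by apply: subringN => //; case: sA.
Qed.

Lemma submod_sum A E (T : Type) (r : seq T) (p : pred T) (f : T -> R) :
  A 1 -> submodule A E -> (forall i, p i -> E (f i)) ->
  E (\sum_(i <- r | p i) f i).
Proof.
move=> A1 sE h; elim/big_rec: _ => [|i x pi Ex]; first by case: sE.
exact: (submodD A1 sE) (h _ pi) Ex.
Qed.

Arguments submod_sum {A E T r p f}.

Lemma subring_submod V : subring V -> submodule V V.
Proof.
move=> sV; split; first exact: subring0.
by move=> a x y Va Vx Vy; apply: subringD => //; apply: subringM.
Qed.

Lemma subring_sum V (T : Type) (r : seq T) (p : pred T) (f : T -> R) :
  subring V -> (forall i, p i -> V (f i)) -> V (\sum_(i <- r | p i) f i).
Proof.
by move=> sV; apply: submod_sum; [case: sV | apply: subring_submod].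
Qed.

Lemma prime_idealX A P x n : subring A -> prime_ideal_of A P -> A x ->
  P (x ^+ n) -> P x.
Proof.
move=> sA [_ P1 hP] Ax; elim: n => [|n IH]; first by rewrite expr0.
by rewrite exprS => /hP[] //; apply: subringX.
Qed.

Lemma setmul0 E F : setmul E F 0.
Proof. by exists 0%N, (fun=> 0), (fun=> 0); split; [case|case|rewrite big_ord0]. Qed.

Lemma setmul_mul E F x y : E x -> F y -> setmul E F (x * y).
Proof.
by move=> Ex Fy; exists 1%N, (fun=> x), (fun=> y); split; rewrite ?big_ord1.
Qed.

Lemma setmulD E F x y : setmul E F x -> setmul E F y -> setmul E F (x + y).
Proof.
move=> [m [e [f [Ee Ff ->]]]] [n [e' [f' [Ee' Ff' ->]]]].
exists (m + n)%N, (fun i => match split i with inl j => e j | inr k => e' k end),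
  (fun i => match split i with inl j => f j | inr k => f' k end); split.
- by move=> i; case: split => j.
- by move=> i; case: split => j.
rewrite big_split_ord /=; congr (_ + _); apply: eq_bigr => i _.
  by rewrite -[lshift _ _]/(unsplit (inl _)) unsplitK.
by rewrite -[rshift _ _]/(unsplit (inr _)) unsplitK.
Qed.

Lemma setmul_min E F (G : set R) : G 0 ->
  (forall x y, G x -> G y -> G (x + y)) ->
  (forall x y, E x -> F y -> G (x * y)) -> setmul E F `<=` G.
Proof.
move=> G0 GD GM _ [m [e [f [Ee Ff ->]]]].
by apply: (big_ind G) => // i _; apply: GM.
Qed.

Lemma setmul_submod E V : subring V -> submodule V (setmul E V).
Proof.
move=> sV; split; first exact: setmul0.
move=> a x y Va Ex; apply: setmulD; move: x Ex; apply: setmul_min.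
- by rewrite mulr0; apply: setmul0.
- by move=> x z; rewrite mulrDr; apply: setmulD.
- by move=> x z Ex Vz; rewrite mulrCA; apply: setmul_mul => //; apply: subringM.
Qed.

Lemma generated_nth A s i : A 0 -> A 1 -> (i < size s)%N -> generated A s s`_i.
Proof.
move=> A0 A1 lt_is; exists (fun j => (j == Ordinal lt_is)%:R).
  by move=> j; case: eqP.
rewrite (bigD1 (Ordinal lt_is)) //= eqxx mul1r big1 ?addr0 // => j /negPf ->.
by rewrite mul0r.
Qed.

Lemma generated_mem A s x : A 0 -> A 1 -> x \in s -> generated A s x.
Proof. by move=> A0 A1 xs; rewrite -(nth_index 0 xs); apply: generated_nth; rewrite ?index_mem. Qed.

Lemma generated_submod A s : subring A -> submodule A (generated A s).
Proof.
move=> sA; split.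
  exists (fun=> 0) => [_|]; first exact: subring0.
  by rewrite big1 // => i _; rewrite mul0r.
move=> a _ _ Aa [c Ac ->] [d Ad ->]; exists (fun i => a * c i + d i).
  by move=> i; apply: subringD => //; apply: subringM.
by rewrite mulr_sumr -big_split; apply: eq_bigr => i _; rewrite mulrDl mulrA.
Qed.

Lemma generated_min A E s : A 1 -> submodule A E -> (forall x, x \in s -> E x) ->
  generated A s `<=` E.
Proof.
move=> A1 sE h _ [c Ac ->]; apply: (submod_sum A1 sE) => i _.
by apply: (submodM sE) => //; apply: h; apply: mem_nth.
Qed.

Lemma ext_poly_submod A E (p q : {poly R}) : A 1 -> submodule A E ->
  ext_poly A p -> ext_poly E q -> ext_poly E (p * q).
Proof.
move=> A1 sE hp hq i; rewrite coefM; apply: (submod_sum A1 sE) => j _.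
by apply: (submodM sE); [apply: hp|apply: hq].
Qed.

Lemma ext_polyD A E (p q : {poly R}) : A 1 -> submodule A E ->
  ext_poly E p -> ext_poly E q -> ext_poly E (p + q).
Proof.
by move=> A1 sE hp hq i; rewrite coefD; apply: (submodD A1 sE).
Qed.

(* Compare the coefficients of least index lying outside [P]. *)
Lemma ext_poly_prime A P (p q : {poly R}) : subring A -> prime_ideal_of A P ->
  ext_poly A p -> ext_poly A q -> ext_poly P (p * q) ->
  ext_poly P p \/ ext_poly P q.
Proof.
move=> sA [[PA sP] P1 hP] Ap Aq Ppq; apply: contrapT => /not_orP [np nq].
have ex (r : {poly R}) : ~ ext_poly P r -> exists i, ~~ `[< P r`_i >].
  by move=> /existsNP [i hi]; exists i; apply/asboolPn.
have [A1 _ _] := sA.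
case: (ex_minnP (ex _ np)) => i /asboolPn Pi mini.
case: (ex_minnP (ex _ nq)) => j /asboolPn Pj minj.
suff : P (p`_i * q`_j) by case/hP.
have lti : (i < (i + j).+1)%N by rewrite ltnS leq_addr.
have := Ppq (i + j)%N; rewrite coefM (bigD1 (Ordinal lti)) //= addKn.
set S := \sum_(_ < _ | _) _ => h; rewrite -[_ * _](addrK S).
apply: (submodD A1 sP) => //; apply: (submodN sA sP).
apply: (submod_sum A1 sP) => k neq_ki.
have [lt_ki|le_ik] := ltnP k i.
  rewrite mulrC; apply: (submodM sP) => //.
  by apply: contrapT => /asboolPn/mini; rewrite leqNgt lt_ki.
have lt_ik : (i < k)%N by rewrite ltn_neqAle le_ik andbT eq_sym.
apply: (submodM sP) => //.
apply: contrapT => /asboolPn/minj; rewrite leqNgt ltn_subLR ?ltn_add2r ?lt_ik //.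
by rewrite -ltnS ltn_ord.
Qed.

End FiniteSums.

Arguments submod_sum {R A E T r p f}.

(** * Unions of chains and Zorn's lemma *)

Section Chains.
Variable T : eqType.

(** In the Zorn arguments below, this moves a failure with a finite witness, such as 1 lying in
    [setmul I C], from the union of a chain to a single member. *)
Lemma chain_bigcup_seq (C : set (set T)) (s : seq T) : total_on C subset ->
  C !=set0 -> (forall x, x \in s -> (\bigcup_(X in C) X) x) ->
  exists2 X, C X & forall x, x \in s -> X x.
Proof.
move=> tC [X0 CX0]; elim: s => [|x s IH] h; first by exists X0.
have [|X CX hX] := IH; first by move=> y ys; apply: h; rewrite inE ys orbT.
have [Y CY Yx] := h x (mem_head _ _).
have [XY|YX] := tC _ _ CX CY.
  by exists Y => // y; rewrite inE => /predU1P[->|/hX/XY].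
by exists X => // y; rewrite inE => /predU1P[->|/hX] //; apply: YX.
Qed.

(** [Zorn_bigcup] also tests the empty chain, whose union is empty. Imposing [Q] on the union of [A]
    and [X0] turns that case into [Q X0]. *)
Lemma Zorn_above (Q : set (set T)) (X0 : set T) : Q X0 ->
  (forall C, C `<=` Q -> C !=set0 -> total_on C subset ->
     Q (\bigcup_(X in C) X)) ->
  exists M, [/\ Q M, X0 `<=` M & forall X, Q X -> M `<=` X -> X = M].
Proof.
move=> QX0 hQ.
have [|A [QA maxA]] := @Zorn_bigcup T [set A | Q (A `|` X0)].
  move=> F FQ tF; have [->|/set0P [Y FY]] := eqVneq F set0.
    by rewrite /= bigcup_set0 set0U.
  rewrite /= (_ : _ `|` _ = \bigcup_(X in [set Z `|` X0 | Z in F]) X).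
    apply: hQ => [_ [Z FZ <-]||_ _ [Z1 FZ1 <-] [Z2 FZ2 <-]]; first exact: FQ.
      by exists (Y `|` X0); exists Y.
    by case: (tF _ _ FZ1 FZ2) => ?; [left|right]; apply: setSU.
  rewrite bigcup_image; apply/seteqP; split => x.
    by case=> [[Z FZ Zx]|X0x]; [exists Z => //; left|exists Y => //; right].
  by case=> Z FZ [Zx|]; [left; exists Z|right].
exists (A `|` X0); split => // X QX sAX; apply/seteqP; split => // x Xx.
apply: contrapT => /not_orP [nAx nX0x].
apply: (maxA X); first by split=> [y Ay|/(_ _ Xx)//]; apply: sAX; left.
by rewrite /= setUidl // => y X0y; apply: sAX; right.
Qed.

End Chains.

(** * Existence of valuation rings *)

Section Valuations.
Variable F : fieldType.
Implicit Types (A B I P V : set F) (p q : {poly F}).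

Definition valuation_ring V : Prop :=
  subring V /\ forall x, x != 0 -> V x \/ V x^-1.

(** The alternative [x = 0] is there because the inverse of 0 is 0, which lies in [V]. *)
Definition nonunits V : set F := [set x | V x /\ (x = 0 \/ ~ V x^-1)].

(** Closure under sums uses that divisibility in [V] is total: if u / v is in [V], then u + v is a
    multiple of v. *)
Lemma nonunits_prime V : valuation_ring V -> prime_ideal_of V (nonunits V).
Proof.
move=> [sV hV]; have [V1 _ _] := sV.
have NM a x : V a -> nonunits V x -> nonunits V (a * x).
  move=> Va [Vx hx]; split; first exact: subringM.
  have [->|a0] := eqVneq a 0; first by left; rewrite mul0r.
  case: hx => [->|nVx]; first by left; rewrite mulr0.
  right=> Vax; apply: nVx; have -> : x^-1 = a * (a * x)^-1.
    by rewrite invfM mulrA divff // mul1r.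
  exact: subringM.
have ND x y : nonunits V x -> nonunits V y -> nonunits V (x + y).
  have main u v : v != 0 -> V (u / v) -> nonunits V v -> nonunits V (u + v).
    move=> v0 Vuv Nv; have -> : u + v = (u / v + 1) * v.
      by rewrite mulrDl divfK // mul1r.
    by apply: NM => //; apply: subringD.
  move=> Nx Ny; have [->|y0] := eqVneq y 0; first by rewrite addr0.
  have [->|x0] := eqVneq x 0; first by rewrite add0r.
  have [Vq|Vq] := hV (x / y) (mulf_neq0 x0 (invr_neq0 y0)).
    exact: main.
  by rewrite addrC; apply: main => //; move: Vq; rewrite invf_div.
split.
- split; first by move=> x [].
  split; first by split; [apply: subring0|left].
  by move=> a x y Va Nx Ny; apply: ND => //; apply: NM.
- by case=> _ [/eqP|]; rewrite ?oner_eq0 // invr1.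
- move=> a b Va Vb [_ hab]; apply: contrapT => /not_orP [na nb].
  have [Nza Via] : a != 0 /\ V a^-1.
    split; first by apply/eqP => a0; apply: na; split; [|left].
    by apply: contrapT => h; apply: na; split; [|right].
  have [Nzb Vib] : b != 0 /\ V b^-1.
    split; first by apply/eqP => b0; apply: nb; split; [|left].
    by apply: contrapT => h; apply: nb; split; [|right].
  case: hab => [/eqP|]; first by rewrite mulf_eq0 (negPf Nza) (negPf Nzb).
  by apply; rewrite invfM; apply: subringM.
Qed.

Lemma nonunits_sub V P : valuation_ring V -> prime_ideal_of V P ->
  P `<=` nonunits V.
Proof.
move=> [sV hV] [[PV sP] P1 _] x Px; split; first exact: PV.
have [->|x0] := eqVneq x 0; first by left.
by right=> Vx; apply: P1; rewrite -(mulVf x0); apply: (submodM sP).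
Qed.

Definition adjoin V (x : F) : set F := [set p.[x] | p in ext_poly V].

Lemma adjoin_subring V x : subring V -> subring (adjoin V x).
Proof.
move=> sV; have [V1 VB _] := sV; split.
- exists 1; last by rewrite hornerC.
  by move=> i; rewrite coef1; case: eqP => _ //; apply: subring0.
- move=> _ _ [p Vp <-] [q Vq <-]; exists (p - q); last by rewrite hornerD hornerN.
  by move=> i; rewrite coefB; apply: VB.
- move=> _ _ [p Vp <-] [q Vq <-]; exists (p * q); last by rewrite hornerM.
  exact: ext_poly_submod (subring_submod sV) Vp Vq.
Qed.

Lemma adjoin_sub V x : subring V -> V `<=` adjoin V x.
Proof.
move=> sV y Vy; exists y%:P; last by rewrite hornerC.
by move=> i; rewrite coefC; case: eqP => _ //; apply: subring0.
Qed.

Lemma adjoin_gen V x : subring V -> adjoin V x x.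
Proof.
move=> sV; exists 'X; last by rewrite hornerX.
by move=> i; rewrite coefX; case: eqP => _; [case: sV|apply: subring0].
Qed.

(* With [p] and [q] of minimal degree [n >= m], the relation for [1 / x]
   rewrites the leading monomial of [p], which lowers the degree of [p]. *)
Lemma unit_relation_descent V J (x : F) p q : subring V -> submodule V J ->
  J `<=` V -> ~ J 1 -> x != 0 ->
  ext_poly J p -> p.[x] = 1 -> ext_poly J q -> q.[x^-1] = 1 ->
  (size q <= size p)%N ->
  exists p', [/\ ext_poly J p', p'.[x] = 1 & (size p' < size p)%N].
Proof.
move=> sV sJ JV J1 x0 Jp px Jq qx leqp.
have [V1 VB _] := sV.
case Dn: (size p) => [|n].
  by move/eqP: Dn; rewrite size_poly_eq0 => /eqP p0; move: px; rewrite p0 horner0 => /esym/eqP; rewrite oner_eq0.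
(* The reversal X^n q(1/X), whose value at [x] is x^n. *)
pose r := \poly_(i < n.+1) q`_(n - i).
have rx : r.[x] = x ^+ n.
  rewrite horner_poly (reindex_inj rev_ord_inj) /=.
  rewrite -[RHS]mulr1 -qx (horner_coef_wide _ (n := n.+1)) -?Dn // mulr_sumr Dn.
  apply: eq_bigr => i _; rewrite subSS subKn -1?ltnS //.
  rewrite mulrCA exprVn; congr (_ * _).
  have le_in : (i <= n)%N by rewrite -ltnS.
  have -> : x ^+ n = x ^+ (n - i) * x ^+ i by rewrite -exprD subnK.
  by rewrite mulfK // expf_neq0.
(* Start from 1 = q_0 + (1 - q_0) p(x) and replace (1 - q_0) x^n in the leading term by the value of
   r - q_0 X^n, which has degree below n. *)
pose p' := (q`_0)%:P + (1 - q`_0) *: (p - p`_n *: 'X^n)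
           + p`_n *: (r - q`_0 *: 'X^n).
have Jr : ext_poly J r.
  by move=> i; rewrite coef_poly; case: ifP => _; [apply: Jq|case: sJ].
have JC c i : J c -> J ((c *: 'X^n)`_i).
  by move=> Jc; rewrite coefZ mulrC; apply: (submodM sJ) => //; rewrite coefXn; case: eqP => _ //; apply: subring0.
exists p'; split.
- move=> i; rewrite !coefD coefC !coefZ !coefB.
  apply: (submodD V1 sJ); first apply: (submodD V1 sJ).
  + by case: ifP => _ //; case: sJ.
  + apply: (submodM sJ); first by apply: VB => //; apply: JV.
    by apply: (submodD V1 sJ) => //; apply: (submodN sV sJ); apply: JC.
  + apply: (submodM sJ); first exact: JV.
    by apply: (submodD V1 sJ) => //; apply: (submodN sV sJ); apply: JC.
- rewrite !(hornerE, hornerXn) px rx /=.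
  ring.
- rewrite ltnS; apply/leq_sizeP => i; rewrite leq_eqVlt => /predU1P[<-|lt_ni].
  + rewrite !(coefD, coefN, coefZ, coefC, coefXn, coef_poly) eqxx ltnSn subnn mulr1.
    (* For n = 0 the constant q_0 sits in the degree to be cancelled; but then [p] is a constant,
       and 1 would lie in [J]. *)
    case: eqP => [n0|_]; last by rewrite mulr1 !subrr !mulr0 !addr0.
    have Jpn : ext_poly J p%R := Jp; case: J1; rewrite -px.
    by rewrite (size1_polyC (_ : size p <= 1)%N) ?Dn ?n0 // hornerC; apply: Jp.
  + rewrite !(coefD, coefN, coefZ, coefC, coefXn, coef_poly).
    rewrite (gtn_eqF lt_ni) (gtn_eqF (leq_ltn_trans (leq0n n) lt_ni)).
    rewrite ltnS leqNgt lt_ni /= [p`_i]nth_default ?Dn //.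
    by rewrite !(mulr0, subr0, addr0).
Qed.

(** Chevalley's theorem: [V] is maximal among the overrings of [B] in which [I] does not generate
    the unit ideal. If [V] contained neither x nor its inverse, maximality would give both a
    polynomial relation with value 1 and coefficients in [J], and the descent could be repeated
    forever. *)
Lemma exists_valuation B I : subring B -> ideal_of B I -> ~ I 1 ->
  exists V, [/\ valuation_ring V, B `<=` V & I `<=` nonunits V].
Proof.
move=> sB [IB sI] I1; have [B1 _ _] := sB.
pose Q C := [/\ subring C, B `<=` C & ~ setmul I C 1].
have [||V [[sV BV nV] _ maxV]] := @Zorn_above F Q B.
- split=> // h; apply: I1; move: 1 h; apply: setmul_min; first by case: sI.
    by move=> x y; apply: (submodD B1 sI).
  by move=> x y Ix By; rewrite mulrC; apply: (submodM sI).
- move=> C CQ C0 tC; have [Z CZ] := C0; have [sZ BZ _] := CQ _ CZ.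
  have dir x y : (\bigcup_(X in C) X) x -> (\bigcup_(X in C) X) y ->
      exists2 X, C X & X x /\ X y.
    move=> Cx Cy; have [|X CX hX] := @chain_bigcup_seq _ C [:: x; y] tC C0.
      by move=> z; rewrite !inE => /orP[/eqP->|/eqP->].
    by exists X => //; split; apply: hX; rewrite !inE eqxx ?orbT.
  split.
  + split; first by exists Z => //; case: sZ.
      move=> x y Cx Cy; have [X CX [Xx Xy]] := dir _ _ Cx Cy; exists X => //.
      by have [[_ h _] _ _] := CQ _ CX; apply: h.
    move=> x y Cx Cy; have [X CX [Xx Xy]] := dir _ _ Cx Cy; exists X => //.
    by have [[_ _ h] _ _] := CQ _ CX; apply: h.
  + by move=> x Bx; exists Z => //; apply: BZ.
  + case=> m [e [f [Ie Cf D1]]].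
    have [|X CX hX] := @chain_bigcup_seq _ C [seq f i | i <- enum 'I_m] tC C0.
      by move=> x /mapP [i _ ->]; apply: Cf.
    have [_ _ n1] := CQ _ CX; apply: n1; exists m, e, f; split=> // i.
    by apply: hX; apply: map_f; rewrite mem_enum.
have [V1 _ _] := sV.
pose J := setmul I V; have sJ : submodule V J := setmul_submod I sV.
have IJ : I `<=` J by move=> x Ix; rewrite -[x]mulr1; apply: setmul_mul.
have JV : J `<=` V.
  apply: setmul_min; first exact: subring0.
    by move=> x y; apply: subringD.
  by move=> x y Ix Vy; apply: subringM => //; apply: BV; apply: IB.
have rel x : ~ V x -> exists p, ext_poly J p /\ p.[x] = 1.
  move=> nVx; have : ~ Q (adjoin V x).
    move=> Qx; apply: nVx; rewrite -(maxV _ Qx); first exact: adjoin_gen.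
    exact: adjoin_sub.
  move=> /not_and3P [||].
  - by case; apply: adjoin_subring.
  - by case; apply: subset_trans BV _; apply: adjoin_sub.
  move=> /contrapT h; suff : setmul I (adjoin V x) `<=` [set p.[x] | p in ext_poly J].
    by move=> /(_ _ h) [p Jp px]; exists p.
  apply: setmul_min.
  - by exists 0; [move=> i; rewrite coef0; case: sJ|rewrite horner0].
  - move=> _ _ [p Jp <-] [q Jq <-]; exists (p + q); last by rewrite hornerD.
    exact: (ext_polyD V1 sJ Jp Jq).
  - move=> a _ Ia [p Vp <-]; exists (a *: p); last by rewrite hornerZ.
    by move=> i; rewrite coefZ; apply: setmul_mul.
exists V; split=> //; last first.
  move=> x Ix; split; first by apply: JV; apply: IJ.
  have [->|x0] := eqVneq x 0; first by left.
  by right=> Vx; apply: nV; rewrite -(divff x0); apply: setmul_mul.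
split=> // x x0; apply: contrapT => /not_orP [/rel [p [Jp px]] /rel [q [Jq qx]]].
(* Each round shortens the longer relation, x and its inverse exchanging roles if that is [q]; the
   sum of the sizes decreases. *)
have [n] := ubnP (size p + size q)%N.
elim: n x p q x0 Jp px Jq qx => // n IH x p q x0 Jp px Jq qx; rewrite ltnS => le_n.
have [le_qp|/ltnW le_pq] := leqP (size q) (size p).
  have [p' [Jp' p'x ltp']] := unit_relation_descent sV sJ JV nV x0 Jp px Jq qx le_qp.
  apply: IH x0 Jp' p'x Jq qx _; apply: leq_trans le_n.
  by rewrite ltn_add2r.
rewrite -(invrK x) in px; have xi0 : x^-1 != 0 by rewrite invr_eq0.
have [q' [Jq' q'x ltq']] := unit_relation_descent sV sJ JV nV xi0 Jq qx Jp px le_pq.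
apply: IH xi0 Jq' q'x Jp px _; apply: leq_trans le_n.
by rewrite addnC ltn_add2l.
Qed.

(** In the localization at [P] the extension of [P] is proper and the elements of [A] outside [P]
    are units, hence units of [V]. This makes the centre equal to [P], not just a prime above it. *)
Lemma exists_valuation_center A P : subring A -> prime_ideal_of A P ->
  exists V, [/\ valuation_ring V, A `<=` V &
                forall x, A x -> (nonunits V x <-> P x)].
Proof.
move=> sA pP; have [[PA sP] P1 hP] := pP; have [A1 _ _] := sA.
pose loc (E : set F) := [set x : F | exists a s, [/\ E a, A s, ~ P s & x = a / s]].
have P0 : P 0 by case: sP.
have nz s : ~ P s -> s != 0 by move=> h; apply/eqP => s0; apply: h; rewrite s0.
have PM s t : A s -> A t -> ~ P s -> ~ P t -> ~ P (s * t).
  by move=> As At ns nt /(hP _ _ As At) [].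
have emb E : E `<=` loc E by move=> x Ex; exists x, 1; rewrite divr1.
have sL : subring (loc A).
  split; first exact: emb.
    move=> _ _ [a [s [Aa As ns ->]]] [b [t [Ab At nt ->]]].
    exists (a * t - b * s), (s * t); split; first case: (sA) => _ hB _.
    - by apply: hB; apply: subringM.
    - exact: subringM.
    - exact: PM.
    - by field; rewrite !nz.
  move=> _ _ [a [s [Aa As ns ->]]] [b [t [Ab At nt ->]]].
  exists (a * b), (s * t); split; [exact: subringM|exact: subringM|exact: PM|].
  by field; rewrite !nz.
have iL : ideal_of (loc A) (loc P).
  split; first by move=> _ [a [s [Pa As ns ->]]]; exists a, s; split=> //; apply: PA.
  split; first exact: emb.
  move=> _ _ _ [c [u [Ac Au nu ->]]] [a [s [Pa As ns ->]]] [b [t [Pb At nt ->]]].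
  exists ((c * t) * a + (u * s) * b), (u * s * t); split.
  - apply: (submodD A1 sP); apply: (submodM sP) => //; exact: subringM.
  - by apply: subringM => //; apply: subringM.
  - by apply: (PM) => //; [apply: subringM|apply: PM].
  - by field; rewrite !nz.
have [|V [vV LV PV]] := exists_valuation sL iL.
  case=> a [s [Pa As ns /esym/divr1_eq e]].
  by apply: ns; rewrite -e.
exists V; split=> // [|x Ax]; first by move=> x Ax; apply: LV; apply: emb.
split=> [[_ hx]|Px]; last by apply: PV; apply: emb.
apply: contrapT => nPx; case: hx => [x0|]; first by apply: nPx; rewrite x0.
by apply; apply: LV; exists 1, x; rewrite div1r.
Qed.

(* The next valuation ring is centred on [Q m.+1 + M] in [A + M], where [M] is
   the maximal ideal of the previous one; containing [M], it is then contained
   in the previous one. *)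
Lemma lift_prime_chain A (Q : nat -> set F) m : subring A ->
  (forall i, (i <= m)%N -> prime_ideal_of A (Q i)) ->
  (forall i, (i < m)%N -> Q i `<` Q i.+1) ->
  exists V (p : nat -> set F),
    [/\ valuation_ring V, A `<=` V, p m = nonunits V,
        forall i, (i <= m)%N ->
          prime_ideal_of V (p i) /\ forall x, A x -> (p i x <-> Q i x) &
        forall i, (i < m)%N -> p i `<=` p i.+1].
Proof.
move=> sA; have [A1 AB AM] := sA; elim: m => [|m IH] pQ ltQ.
  have [V [vV AV cV]] := exists_valuation_center sA (pQ 0%N isT).
  exists V, (fun=> nonunits V); split=> // i; rewrite leqn0 => /eqP ->.
  by split=> //; apply: nonunits_prime.
have [||V [p [vV AV pmV pV incp]]] := IH.
- by move=> i le_im; apply: pQ; apply: leqW.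
- by move=> i lt_im; apply: ltQ; apply: leqW.
have [sV hV] := vV; have [V1 VB VM] := sV.
pose M := nonunits V; have [[MV sM] M1 pM] := nonunits_prime vV.
have [[QA sQ] Q1 hQ] := pQ m.+1 (leqnn _).
have MQ x : A x -> M x -> Q m.+1 x.
  move=> Ax Mx; apply: (ltQ m (leqnn _)).1.
  by apply/(pV m (leqnn _)).2 => //; rewrite pmV.
pose ext (E : set F) := [set x : F | exists a y, [/\ E a, M y & x = a + y]].
have embE E : E `<=` ext E by move=> x Ex; exists x, 0; rewrite addr0; split=> //; case: sM.
have MD x y : M x -> M y -> M (x + y) by apply: (submodD V1 sM).
have MM a x : V a -> M x -> M (a * x) by apply: (submodM sM).
have MN x : M x -> M (- x) by apply: (submodN sV sM).
(* [A] meets [M] in [Q m], which is part of [Q m.+1]; so adding [M] to [Q m.+1] brings in no new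
   element of [A]. *)
have extQ x : A x -> ext (Q m.+1) x -> Q m.+1 x.
  move=> Ax [q [y [Qq My e]]]; rewrite e; apply: (submodD A1 sQ) => //.
  by apply: MQ => //; have -> : y = x - q; [rewrite e addrC addKr|apply: AB => //; apply: QA].
have sB : subring (ext A).
  split; first exact: embE.
    move=> _ _ [a [y [Aa My ->]]] [b [z [Ab Mz ->]]]; exists (a - b), (y - z).
    split; [exact: AB|by apply: (MD) => //; apply: MN|ring].
  move=> _ _ [a [y [Aa My ->]]] [b [z [Ab Mz ->]]].
  exists (a * b), (a * z + ((b + z) * y)); split; [exact: AM| |ring].
  apply: (MD); apply: MM => //; first exact: AV.
  by apply: subringD => //; [apply: AV|apply: MV].
have pB : prime_ideal_of (ext A) (ext (Q m.+1)).
  split.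
  - split; first by move=> _ [a [y [Qa My ->]]]; exists a, y; split=> //; apply: QA.
    split; first by apply: embE; case: sQ.
    move=> _ _ _ [a [y [Aa My ->]]] [b [z [Qb Mz ->]]] [c [w [Qc Mw ->]]].
    exists (a * b + c), (a * z + (b + z) * y + w); split; last by ring.
      by case: sQ => _; apply.
    apply: (MD) => //; apply: (MD); apply: MM => //; first exact: AV.
    by apply: subringD => //; [apply: AV; apply: QA|apply: MV].
  - by move=> /(extQ _ A1).
  - move=> _ _ [a [y [Aa My ->]]] [b [z [Ab Mz ->]]] [q [w [Qq Mw e]]].
    have : Q m.+1 (a * b).
      apply: extQ; first exact: AM.
      exists q, (w - (a * z + (b + z) * y)); split=> //.
        apply: (MD) => //; apply: MN; apply: (MD); apply: MM => //; first exact: AV.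
        by apply: subringD => //; [apply: AV|apply: MV].
      by rewrite addrA -e; ring.
    by case/(hQ _ _ Aa Ab) => ?; [left|right]; [exists a, y|exists b, z].
have [V' [vV' BV' cV']] := exists_valuation_center sB pB.
have MB : M `<=` ext A.
  by move=> x Mx; exists 0, x; rewrite add0r; split=> //; apply: subring0.
have V'V : V' `<=` V.
  move=> x V'x; apply: contrapT => nVx.
  have x0 : x != 0 by apply/eqP => x0; apply: nVx; rewrite x0; apply: subring0.
  have Mx : M x^-1.
    by have [//|Vx] := hV _ x0; split=> //; right; rewrite invrK.
  have : nonunits V' x^-1.
    apply/cV'; first exact: MB.
    by exists 0, x^-1; rewrite add0r; split=> //; case: sQ.
  by case=> _ [/eqP|]; rewrite ?invr_eq0 ?(negPf x0) // invrK.
exists V', (fun i => if (i <= m)%N then p i else nonunits V'); split=> //.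
- by move=> x Ax; apply: BV'; apply: embE.
- by rewrite ltnn.
- move=> i; rewrite leq_eqVlt => /predU1P[->|].
    rewrite ltnn; split=> [|x Ax]; first exact: nonunits_prime.
    rewrite cV'; last exact: embE.
    by split; [apply: extQ|apply: embE].
  (* The earlier primes lie in [M], hence in [V'], and stay prime because [V'] is contained in
     [V]. *)
  rewrite ltnS => le_im; rewrite le_im; have [pi ci] := pV _ le_im; split=> //.
  have piM := nonunits_sub vV pi; have [[piV [pi0 spi]] pi1 hpi] := pi.
  split=> //.
    split; first by move=> x /piM/MB/BV'.
    by split=> // a x y V'a; apply: spi; apply: V'V.
  by move=> a b V'a V'b; apply: hpi; apply: V'V.
- move=> i; rewrite ltnS => le_im; rewrite le_im; case: ltngtP le_im => // [lt_im _|-> _].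
    exact: incp.
  rewrite pmV => x Mx; apply/cV'; first exact: MB.
  by exists 0, x; rewrite add0r; split=> //; case: sQ.
Qed.

End Valuations.

(** * Quasi-primes of a semistar operation *)

Section Fractions.
Variable D : idomainType.
Local Notation K := {fraction D}.
Implicit Types (E F : set K) (I P M : set D).

Lemma fracP (x : K) : exists a b : D, b != 0 /\ x = tofrac a / tofrac b.
Proof.
elim/quotW: x => y; exists y.1, y.2; have d0 := denom_ratioP y; split=> //.
have d0' : tofrac y.2 != 0 by rewrite tofrac_eq0.
apply: (mulIf d0'); rewrite divfK //.
unlock FracField.tofrac; rewrite -[LHS]FracField.pi_mul.
apply/eqmodP; rewrite /= FracField.equivfE.
by rewrite /FracField.mulf !numden_Ratio ?mulf_neq0 ?oner_neq0 ?mulr1 // mulrC.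
Qed.

Lemma tofrac_inj : injective (@FracField.tofrac D).
Proof. by move=> a b /eqP; rewrite tofrac_eq => /eqP. Qed.

Lemma base_subring : subring (@base D).
Proof.
split; first by exists 1; rewrite ?tofrac1.
  by move=> _ _ [a _ <-] [b _ <-]; exists (a - b) => //; rewrite tofracB.
by move=> _ _ [a _ <-] [b _ <-]; exists (a * b) => //; rewrite tofracM.
Qed.

Lemma base1 : @base D 1. Proof. by case: base_subring. Qed.

Lemma base_tofrac (a : D) : base (tofrac a). Proof. by exists a. Qed.

Lemma embE I a : emb I (tofrac a) <-> I a.
Proof. by split=> [[b Ib /tofrac_inj <-]|Ia] //; exists a. Qed.

Lemma emb_submod I : ideal I -> submodule (@base D) (emb I).
Proof.
case=> _ [I0 hI]; split; first by exists 0; rewrite ?tofrac0.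
move=> _ _ _ [a _ <-] [x Ix <-] [y Iy <-]; exists (a * x + y); first exact: hI.
by rewrite tofracD tofracM.
Qed.

Lemma ideal_nonzero I : ideal I -> I <> [set 0] -> nonzero_set I.
Proof.
move=> [_ [I0 _]] nI; apply: contrapT => h; apply: nI; apply/seteqP; split.
  by move=> x Ix; apply: contrapT => /eqP x0; apply: h; exists x.
by move=> _ ->.
Qed.

Lemma ideal1 I : ideal I -> I 1 -> I = setT.
Proof.
move=> [_ sI] I1; apply/seteqP; split=> // x _.
by rewrite -[x]mulr1; apply: (submodM sI).
Qed.

Lemma prime_ideal0 : prime_ideal [set 0 : D].
Proof.
split; first (split=> //; split=> // a x y _ -> ->; last by rewrite mulr0 addr0).
  by apply/eqP; rewrite oner_eq0.
by move=> a b _ _ /eqP; rewrite mulf_eq0 => /orP [] /eqP; [left|right].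
Qed.

Lemma setT_subring (R : comNzRingType) : subring [set: R].
Proof. by split. Qed.

Lemma emb_seq P (s : seq K) : (forall x, x \in s -> emb P x) ->
  exists2 t, s = map (@FracField.tofrac D) t & forall a, a \in t -> P a.
Proof.
elim: s => [|x s IH] h; first by exists [::].
have [|t -> Pt] := IH; first by move=> y ys; apply: h; rewrite inE ys orbT.
have [a Pa <-] := h x (mem_head _ _); exists (a :: t) => // b.
by rewrite inE => /predU1P [->|/Pt].
Qed.

Lemma gen_sub_emb P (t : seq D) : ideal P -> (forall a, a \in t -> P a) ->
  generated (@base D) (map (@FracField.tofrac D) t) `<=` emb P.
Proof.
move=> iP Pt; apply: generated_min base1 (emb_submod iP) _.
by move=> _ /mapP [a /Pt Pa ->]; apply/embE.
Qed.

Lemma fgen_submod E : fgen E -> submodule (@base D) E.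
Proof. by case=> _ [s ->]; apply: generated_submod; apply: base_subring. Qed.

Lemma fgen_Fbar E : fgen E -> Fbar E.
Proof. by move=> fE; split; [apply: fgen_submod|case: fE]. Qed.

Lemma fgen_generated (s : seq K) x : x \in s -> x != 0 -> fgen (generated (@base D) s).
Proof.
move=> xs x0; split; last by exists s.
exists x => //; apply: generated_mem xs; last exact: base1.
exact: subring0 base_subring.
Qed.

Lemma generated_base_mem (s : seq K) x : x \in s -> generated (@base D) s x.
Proof. by apply: generated_mem; [exact: subring0 base_subring|exact: base1]. Qed.

Lemma fgen_join E F1 F2 : submodule (@base D) E -> fgen F1 -> fgen F2 ->
  F1 `<=` E -> F2 `<=` E ->
  exists F, [/\ fgen F, F `<=` E, F1 `<=` F & F2 `<=` F].
Proof.
move=> sE [[x F1x x0] [s1 e1]] [_ [s2 e2]] F1E F2E.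
pose F := generated (@base D) (s1 ++ s2).
have sF : submodule (@base D) F by apply: generated_submod base_subring.
have F1F : F1 `<=` F.
  rewrite e1; apply: generated_min base1 sF _ => y ys.
  by apply: generated_base_mem; rewrite mem_cat ys.
exists F; split=> //.
- by split; [exists x => //; apply: F1F|exists (s1 ++ s2)].
- apply: generated_min base1 sE _ => y; rewrite mem_cat => /orP [ys|ys].
    by apply: F1E; rewrite e1; apply: generated_base_mem.
  by apply: F2E; rewrite e2; apply: generated_base_mem.
- rewrite e2; apply: generated_min base1 sF _ => y ys.
  by apply: generated_base_mem; rewrite mem_cat ys orbT.
Qed.

End Fractions.

Section SemistarPrimes.
Variable D : idomainType.
Local Notation K := {fraction D}.
Implicit Types (E F : set K) (I P M : set D) (star : set K -> set K).

Definition star_primes star : set (set D) :=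
  [set P | prime_ideal P /\
     (P = [set 0] \/ star_f star (emb P) `<` star (@base D))].

(** The set [s] is uniform in [P']: its elements become the coefficients of one polynomial that
    avoids all the primes of [G] at once. *)
Definition primes_of_finite_type (G : set (set D)) : Prop :=
  forall P, prime_ideal P -> ~ G P ->
    exists2 s : seq D, (forall a, a \in s -> P a) &
      forall P', G P' -> exists2 a, a \in s & ~ P' a.

Lemma star_primes0 star : star_primes star [set 0].
Proof. by split; [apply: prime_ideal0|left]. Qed.

Variable star : set K -> set K.
Hypothesis hstar : semistar star.

Lemma base_Fbar : Fbar (@base D).
Proof.
split; first exact: subring_submod (base_subring D).
by exists 1; [apply: base1|apply: oner_neq0].
Qed.

(** If 1 is in the closure of [F], that closure contains [D], hence by idempotence the closure of
    [D]. Properness is thus tested on 1. *)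
Lemma star_f_base_proper I : ideal I -> 
  (star_f star (emb I) `<` star (@base D)) <-> ~ star_f star (emb I) 1.
Proof.
move=> iI; split=> [[_ h]|h].
  case=> F [fF FI] F1; apply: h => x bx; exists F => //.
  have Fb := fgen_Fbar fF; rewrite -(semistar_idem hstar Fb).
  have Fbs := semistar_Fbar hstar Fb.
  apply: (semistar_mono hstar base_Fbar Fbs) bx => _ [a _ <-].
  by case: Fbs => sF _; rewrite -[tofrac a]mulr1; apply: (submodM sF) F1; apply: base_tofrac.
split=> [x [F [fF FI] Fx]|].
  apply: (semistar_mono hstar (fgen_Fbar fF) base_Fbar) Fx.
  by apply: subset_trans FI _ => _ [a _ <-]; apply: base_tofrac.
by move=> /(_ 1 (semistar_ext hstar base_Fbar (@base1 D)))/h.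
Qed.

Lemma star_primesE P : star_primes star P <->
  prime_ideal P /\ (P = [set 0] \/ ~ star_f star (emb P) 1).
Proof.
split=> [[pP hP]|[pP hP]]; have [iP _ _] := pP; split=> //.
  by case: hP => [|/(star_f_base_proper iP)]; [left|right].
by case: hP => [|/(star_f_base_proper iP)]; [left|right].
Qed.

Lemma star_f_mono E F : E `<=` F -> star_f star E `<=` star_f star F.
Proof.
move=> EF x [G [fG GE] Gx]; exists G => //; split=> //.
exact: subset_trans GE EF.
Qed.

Lemma star_primes_sub P P' : star_primes star P -> prime_ideal P' ->
  P' `<=` P -> star_primes star P'.
Proof.
move=> /star_primesE [pP hP] pP' sub; apply/star_primesE; split=> //.
have [iP' _ _] := pP'.
case: hP => [P0|hP].
  left; apply/seteqP; split; first by rewrite -P0.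
  by move=> _ ->; case: iP' => _ [].
by right=> h; apply: hP; apply: star_f_mono h; apply: image_subset.
Qed.

(** The finite set generates an [F] inside [P] whose closure contains 1; a nonzero prime containing
    these generators has 1 in its own closure. *)
Lemma star_primes_finite_type : primes_of_finite_type (star_primes star).
Proof.
move=> P pP; move/star_primesE => /not_andP [//|/not_orP [_ /contrapT]].
case=> F [fF FP] F1; have [[x Fx x0] [s' es']] := fF.
have [|s es Ps] := @emb_seq _ P s'.
  by move=> y ys; apply: FP; rewrite es'; apply: generated_base_mem.
exists s => // P' /star_primesE [pP' hP'].
apply: contrapT => h; have P's a : a \in s -> P' a.
  by move=> sa; apply: contrapT => ?; apply: h; exists a.
have [iP' _ _] := pP'.
have FP' : F `<=` emb P' by rewrite es' es; apply: gen_sub_emb.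
case: hP' => [P'0|]; last by apply; exists F.
by have [b] := FP' _ Fx; rewrite P'0 => -> xe; rewrite -xe tofrac0 eqxx in x0.
Qed.

Section QuasiIdeals.
Variable I : set D.
Hypotheses (iI : ideal I) (nzI : nonzero_set I).

Lemma star_f_seq (xs : seq K) : (forall x, x \in xs -> star_f star (emb I) x) ->
  exists F, [/\ fgen F, F `<=` emb I & forall x, x \in xs -> star F x].
Proof.
elim: xs => [|x xs IH] h.
  (* Even for the empty list [F] must be nonzero, so a nonzero element of [I] generates it. *)
  have [a Ia a0] := nzI; exists (generated (@base D) (map (@FracField.tofrac D) [:: a])).
  split=> //; last by apply: gen_sub_emb => // b; rewrite inE => /eqP ->.
  by apply: (@fgen_generated _ _ (tofrac a)); rewrite ?tofrac_eq0 // inE.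
have [|F2 [f2 F2I hF2]] := IH; first by move=> y ys; apply: h; rewrite inE ys orbT.
have [F1 [f1 F1I] F1x] := h x (mem_head _ _).
have [F [fF FI F1F F2F]] := fgen_join (emb_submod iI) f1 f2 F1I F2I.
exists F; split=> // y; rewrite inE => /predU1P [->|/hF2].
  exact: (semistar_mono hstar (fgen_Fbar f1) (fgen_Fbar fF)) F1x.
exact: (semistar_mono hstar (fgen_Fbar f2) (fgen_Fbar fF)).
Qed.

Lemma star_f_ext : emb I `<=` star_f star (emb I).
Proof.
move=> _ [a Ia <-]; have [b Ib b0] := nzI.
have fF : fgen (generated (@base D) (map (@FracField.tofrac D) [:: a; b])).
  apply: (@fgen_generated _ _ (tofrac b)); rewrite ?tofrac_eq0 //.
  by rewrite !inE eqxx orbT.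
exists (generated (@base D) (map (@FracField.tofrac D) [:: a; b])).
  split=> //; apply: gen_sub_emb => // c.
  by rewrite !inE => /orP [] /eqP ->.
apply: (semistar_ext hstar (fgen_Fbar fF)).
by apply: generated_base_mem; rewrite inE eqxx.
Qed.

Let J : set D := @FracField.tofrac D @^-1` star_f star (emb I).

Lemma star_f_closure_ideal : ideal J.
Proof.
split=> //; split.
  by apply: star_f_ext; exists 0; [case: iI => _ []|].
move=> a x y _ Jx Jy; have [|F [fF FI hF]] := @star_f_seq [:: tofrac x; tofrac y].
  by move=> z; rewrite !inE => /orP [] /eqP ->.
exists F => //; rewrite tofracD tofracM.
have [[_ h] _] := semistar_Fbar hstar (fgen_Fbar fF).
by apply: h; [apply: base_tofrac| |]; apply: hF; rewrite !inE eqxx ?orbT.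
Qed.

Lemma star_f_closure_idem : star_f star (emb J) 1 -> star_f star (emb I) 1.
Proof.
case=> F [fF FJ] F1; have [_ [s es]] := fF.
have [|G [fG GI hG]] := @star_f_seq s.
  move=> x xs; have [|a Ja <-] := FJ x; last exact: Ja.
  by rewrite es; apply: generated_base_mem.
exists G => //; have bG := fgen_Fbar fG; rewrite -(semistar_idem hstar bG).
have bGs := semistar_Fbar hstar bG.
apply: (semistar_mono hstar (fgen_Fbar fF) bGs) F1.
by rewrite es; apply: generated_min (@base1 D) _ _ => //; case: bGs.
Qed.

End QuasiIdeals.

(** Zorn applies to the condition that 1 is not in the closure, since finitely generated modules
    witness its failure. The contraction of the closure of [M] satisfies the same condition, so a
    maximal [M] equals it and is a quasi-ideal. *)
Lemma exists_QMax I : ideal I -> nonzero_set I -> ~ star_f star (emb I) 1 ->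
  exists2 M, QMax (star_f star) M & I `<=` M.
Proof.
move=> iI nzI I1.
have [||M [[iM M1] IM maxM]] :=
    @Zorn_above D [set M | ideal M /\ ~ star_f star (emb M) 1] I.
- by [].
- move=> C CQ C0 tC; have [Z CZ] := C0; have [iZ _] := CQ _ CZ.
  split.
    split=> //; split; first by exists Z => //; case: iZ => _ [].
    move=> a x y _ Cx Cy; have [|X CX hX] := @chain_bigcup_seq _ C [:: x; y] tC C0.
      by move=> z; rewrite !inE => /orP[/eqP->|/eqP->].
    exists X => //; have [[_ [_ h]] _] := CQ _ CX.
    by apply: h => //; apply: hX; rewrite !inE eqxx ?orbT.
  case=> F [fF FC] F1; have [_ [s' es']] := fF.
  have [|s es Cs] := @emb_seq _ (\bigcup_(X in C) X) s'.
    by move=> x xs; apply: FC; rewrite es'; apply: generated_base_mem.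
  have [X CX hX] := chain_bigcup_seq tC C0 Cs.
  have [iX] := CQ _ CX; apply; exists F => //; split=> //.
  by rewrite es' es; apply: gen_sub_emb.
have nzM : nonzero_set M by have [a Ia a0] := nzI; exists a => //; apply: IM.
have MJ : M `<=` @FracField.tofrac D @^-1` star_f star (emb M).
  by move=> a Ma; apply: (star_f_ext iM nzM); exists a.
exists M => //; split; last first.
  move=> I' [[iI' nzI' eI'] I'T] MI'; apply: maxM => //; split=> // h.
  by apply: I'T; apply: ideal1 => //; rewrite -eI' /preimage /= tofrac1.
split; last first.
  by move=> MT; apply: M1; apply: (star_f_ext iM nzM); exists 1; rewrite ?MT ?tofrac1.
split=> //; apply: maxM => //; split; first exact: star_f_closure_ideal.
by move=> /(star_f_closure_idem iM nzM).
Qed.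

Lemma QMax_proper M : QMax (star_f star) M ->
  ideal M /\ ~ star_f star (emb M) 1.
Proof.
move=> [[[iM nzM eM] MT] _]; split=> // h; apply: MT; apply: ideal1 => //.
by rewrite -eM /preimage /= tofrac1.
Qed.

(** If 1 is in the [star_f]-closure of [P], then [P] lies in no maximal quasi-ideal [M], so it
    generates 1 in every localization and is not a [star_tilde]-quasi-ideal. Otherwise some such [M]
    contains [P], and the extension of [P] to the localization at [M] already contracts to [P]. *)
Lemma QSpec_star_tilde P :
  QSpec (star_tilde star) P <-> star_primes star P /\ nonzero_set P.
Proof.
split=> [[pP [iP nzP eP]]|[/star_primesE [pP hP] nzP]].
  split=> //; apply/star_primesE; split=> //; right=> h.
  have [_ P1 _] := pP; apply: P1; rewrite -eP => M qM.
  have [iM M1] := QMax_proper qM; rewrite tofrac1.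
  have [a [Pa nMa]] : exists a, P a /\ ~ M a.
    apply: contrapT => /forallNP sub; apply: M1; apply: star_f_mono h.
    by apply: image_subset => a Pa; apply: contrapT => nMa; apply: (sub a).
  have a0 : tofrac a != 0.
    by rewrite tofrac_eq0; apply/eqP => a0; apply: nMa; rewrite a0; case: iM => _ [].
  rewrite -(divff a0) -div1r; apply: setmul_mul; first by exists a.
  by exists 1, a; rewrite tofrac1.
have [iP P1 hp] := pP.
have {}hP : ~ star_f star (emb P) 1.
  by case: hP => // P0; case: nzP => x; rewrite P0 => -> /eqP.
have [M qM PM] := exists_QMax iP nzP hP; have [iM M1] := QMax_proper qM.
split=> //; split=> //; apply/seteqP; split=> a.
  move=> /(_ M qM); rewrite /preimage /=.
  suff sub : setmul (emb P) (local_at M) `<=`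
      [set x | exists p s, [/\ P p, ~ P s & x = tofrac p / tofrac s]].
    case/sub => p [s [Pp nPs e]].
    have s0 : tofrac s != 0.
      by rewrite tofrac_eq0; apply/eqP => s0; apply: nPs; rewrite s0; case: iP => _ [].
    have : P (a * s).
      by have -> : a * s = p by apply: tofrac_inj; rewrite tofracM e divfK.
    by case/(hp _ _ I I) => // /nPs.
  have nz s : ~ P s -> tofrac s != 0.
    by move=> nPs; rewrite tofrac_eq0; apply/eqP => s0; apply: nPs; rewrite s0; case: iP => _ [].
  have nPM s t : ~ P s -> ~ P t -> ~ P (s * t) by move=> ? ? /(hp _ _ I I) [].
  have PD := @submodD _ setT P _ _ I iP.2.
  have PM' := @submodM _ setT P _ _ iP.2 I.
  apply: setmul_min.
  - by exists 0, 1; rewrite tofrac0 mul0r; split=> //; case: iP => _ [].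
  - move=> _ _ [p [s [Pp ns ->]]] [q [t [Pq nt ->]]].
    exists (t * p + s * q), (s * t); split; [|exact: nPM|].
      by apply: PD; apply: PM'.
    by rewrite addf_div ?nz // tofracD 3!tofracM [X in X + _]mulrC [X in _ + X]mulrC.
  - move=> _ _ [p Pp <-] [b [s [nMs ->]]].
    exists (b * p), s; split; first exact: PM'.
      by move=> /PM.
    by rewrite tofracM mulrCA mulrA.
move=> Pa M' qM'; have [iM' M'1] := QMax_proper qM'.
rewrite -[tofrac a]mulr1; apply: setmul_mul; first by exists a.
exists 1, 1; rewrite tofrac1 divr1; split=> // h.
have [[_ MT] _] := qM'; apply: MT; exact: ideal1.
Qed.

(** The content [E] of [f] in [Q] is invertible at [P]: some x in its inverse has u = x f_i outside
    [P]. With g = x f in [D[X]] one gets u f = f_i g. As g has the coefficient u, it is outside [Q],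
    so f_i is in [Q]; then u f_j = f_i g_j is in [Q] while u is not, and every f_j is in [Q]. *)
Lemma PsMD_quasi_prufer : PsMD star -> quasi_prufer (star_tilde star).
Proof.
move=> hD Q pQ [P qP QP]; have [[_ sQ] Q1 hQ] := pQ.
have [/star_primesE [pP hP] nzP] := (QSpec_star_tilde P).1 qP.
have [iP P1 hp] := pP.
have {}hP : ~ star_f star (emb P) 1.
  by case: hP => // P0; case: nzP => x; rewrite P0 => -> /eqP.
apply/seteqP; split; last first.
  move=> f Qf; rewrite -[f]coefK poly_def.
  apply: (@submod_sum _ setT Q _ _ _ _ I sQ) => i _.
  by rewrite -mul_polyC mulrC; apply: (submodM sQ) => //; apply: Qf.
move=> f Qf; have [f0|f0] := eqVneq f 0.
  by move=> i; rewrite f0 coef0 /contraction /preimage /= polyC0; case: sQ.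
pose E := generated (@base D) (map (@FracField.tofrac D) f).
have Ef i : E (tofrac f`_i).
  have [le_i|lt_i] := leqP (size f) i.
    rewrite nth_default // tofrac0.
    by case: (generated_submod (map (@FracField.tofrac D) f) (base_subring D)).
  by apply: generated_base_mem; apply: map_f; apply: mem_nth.
have fE : fgen E.
  split; last by eexists.
  by exists (tofrac (lead_coef f)); rewrite ?tofrac_eq0 ?lead_coef_eq0 //; apply: Ef.
have : star_f star (setmul E (inv_frac E)) 1.
  by rewrite (hD _ fE); apply: (semistar_ext hstar base_Fbar (@base1 D)).
case=> F [fF FE] F1.
(* If all products x f_i were in [P], then [F] would be inside [P], and 1 in the closure of [P]. *)
have [i [x [hx [u [nPu eu]]]]] : exists i x, inv_frac E x /\
    exists u, ~ P u /\ tofrac f`_i * x = tofrac u.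
  apply: contrapT => nex; apply: hP; exists F => //; split=> //.
  apply: subset_trans FE _.
  have sP := emb_submod iP.
  apply: setmul_min; first by case: sP.
    by move=> a b; apply: (submodD (@base1 D) sP).
  move=> _ x [c bc ->] hx; rewrite mulr_suml.
  apply: (submod_sum (@base1 D) sP) => i _; rewrite -mulrA; apply: (submodM sP) => //.
  have lti : (i < size f)%N by rewrite -(size_map (@FracField.tofrac D)).
  rewrite (nth_map 0) //; have [u _ eu] := hx _ (Ef i).
  rewrite mulrC -eu; apply/embE; apply: contrapT => nPu; apply: nex.
  by exists i, x; split=> //; exists u; rewrite mulrC.
have [g eg] : exists g : {poly D}, forall j, tofrac g`_j = x * tofrac f`_j.
  have ch j : exists a, tofrac a = x * tofrac f`_j.
    by have [a _ <-] := hx _ (Ef j); exists a.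
  have [h hh] := choice ch; exists (\poly_(j < size f) h j) => j.
  rewrite coef_poly; case: ltnP => // le_j.
  by rewrite [f`_j]nth_default // tofrac0 mulr0.
have ufg j : u * f`_j = f`_i * g`_j.
  by apply: tofrac_inj; rewrite 2!tofracM eg -eu mulrA mulrAC.
have Qfi : Q (f`_i)%:P.
  have : Q ((f`_i)%:P * g).
    have -> : (f`_i)%:P * g = u%:P * f by apply/polyP => j; rewrite !coefCM ufg.
    exact: (submodM sQ).
  case/(hQ _ _ I I) => // /QP /(_ i).
  have -> : g`_i = u by apply: tofrac_inj; rewrite eg mulrC.
  by [].
move=> j; rewrite /contraction /preimage /=.
have : Q (u%:P * (f`_j)%:P).
  by rewrite -polyCM ufg polyCM mulrC; apply: (submodM sQ).
case/(hQ _ _ I I) => // /QP /(_ 0%N); by rewrite coefC.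
Qed.

End SemistarPrimes.

(** * The semistar operation on the polynomial ring *)

Section PolynomialSemistar.
Variable D : idomainType.
Local Notation R1 := {poly D}.
Local Notation K1 := {fraction R1}.
Variable star : set {fraction D} -> set {fraction D}.
Implicit Types (Q : set R1) (E V : set K1) (t : {poly R1}).

Lemma contraction_prime Q : prime_ideal Q -> prime_ideal (contraction Q).
Proof.
move=> [[_ [Q0 sQ]] Q1 hQ]; split.
- split=> //; split=> [|a x y _ Qx Qy]; first by rewrite /contraction /preimage /= polyC0.
  by rewrite /contraction /preimage /= polyCD polyCM; apply: sQ.
- by rewrite /contraction /preimage /= polyC1.
- by move=> a b _ _; rewrite /contraction /preimage /= polyCM; apply: hQ.
Qed.

Lemma ThetaE Q : Theta star Q <->
  prime_ideal Q /\ star_primes star (contraction Q).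
Proof.
split=> [[pQ hQ]|[pQ [_ hQ]]]; split=> //; split=> //.
exact: contraction_prime.
Qed.

Lemma Theta0 : Theta star [set 0].
Proof.
apply/ThetaE; split; first exact: prime_ideal0.
have -> : contraction [set 0 : R1] = [set 0].
  by apply/seteqP; split=> a /eqP; rewrite ?polyC_eq0 => /eqP // ->.
exact: star_primes0.
Qed.

Lemma SmultP t : Smult star t <-> forall Q, Theta star Q -> ~ ext_poly Q t.
Proof.
split=> [h Q tQ Qt|h [Q tQ Qt]]; last exact: h tQ Qt.
by apply: h; exists Q.
Qed.

Lemma Smult_neq0 t : Smult star t -> t != 0.
Proof.
move=> /SmultP h; apply/eqP => t0; apply: (h _ Theta0) => i.
by rewrite t0 coef0.
Qed.

Lemma Smult1 : Smult star 1.
Proof.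
apply/SmultP => Q /ThetaE [[_ Q1 _] _] /(_ 0%N).
by rewrite coef1.
Qed.

Lemma SmultM t u : Smult star t -> Smult star u -> Smult star (t * u).
Proof.
move=> /SmultP ht /SmultP hu; apply/SmultP => Q tQ.
have /ThetaE [pQ _] := tQ.
by case/(ext_poly_prime (setT_subring _) pQ) => //; [apply: ht|apply: hu].
Qed.

(** The numerator is forced to be [z] times the denominator, so membership only asks for a
    multiplier that carries [z] into [E[Y]]. *)
Lemma star_polyP E z : star_poly star E z <->
  exists2 t, Smult star t & forall i, E (z * tofrac t`_i).
Proof.
have nz t : Smult star t -> tofrac (map_poly (@FracField.tofrac R1) t) != 0.
  move=> /Smult_neq0 t0; rewrite tofrac_eq0 map_poly_eq0_id0 // tofrac_eq0.
  by rewrite lead_coef_eq0.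
split=> [[g [t [Eg St e]]]|[t St Et]].
  exists t => // i; have := Eg i.
  have <- : z%:P * map_poly (@FracField.tofrac R1) t = g.
    by apply: tofrac_inj; rewrite tofracM e divfK ?nz.
  by rewrite coefCM coef_map.
exists (z%:P * map_poly (@FracField.tofrac R1) t), t; split=> //.
  by move=> i; rewrite coefCM coef_map; apply: Et.
by rewrite tofracM mulfK ?nz.
Qed.

Lemma star_poly_mono E E' : E `<=` E' -> star_poly star E `<=` star_poly star E'.
Proof.
move=> EE' z /star_polyP [t St Et]; apply/star_polyP; exists t => // i.
exact: EE'.
Qed.

Lemma star_poly_ext E : submodule (@base R1) E -> E `<=` star_poly star E.
Proof.
move=> sE z Ez; apply/star_polyP; exists 1; first exact: Smult1.
by move=> i; rewrite mulrC; apply: (submodM sE) Ez; apply: base_tofrac.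
Qed.

Lemma star_poly_Theta Q : Theta star Q -> ~ star_poly star (emb Q) 1.
Proof.
move=> tQ /star_polyP [t /SmultP St h]; apply: (St _ tQ) => i.
by have := h i; rewrite mul1r => /embE.
Qed.

Section FiniteType.
Hypothesis ftG : primes_of_finite_type (star_primes star).

(** Membership of a prime in [Theta] depends only on its contraction, so constants suffice. *)
Lemma Theta_finite_type : primes_of_finite_type (Theta star).
Proof.
move=> Q pQ nQ; have [|s Qs hs] := ftG (contraction_prime pQ).
  by move=> h; apply: nQ; apply/ThetaE.
exists (map polyC s) => [_ /mapP [a sa ->]|Q' /ThetaE [_ /hs [a sa nQ'a]]].
  exact: Qs.
by exists a%:P => //; apply: map_f.
Qed.

(* [\sum_i s_i Y^i] is a multiplier as soon as no prime of [Theta] contains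
   all the [s_i]. *)
Lemma not_Theta_Smult Q : prime_ideal Q -> ~ Theta star Q ->
  exists2 s : seq R1, (forall a, a \in s -> Q a) & Smult star (Poly s).
Proof.
move=> pQ nQ; have [s Qs hs] := Theta_finite_type pQ nQ; exists s => //.
apply/SmultP => Q' /hs [a sa nQ'a] h; apply: nQ'a.
by have := h (index a s); rewrite coef_Poly nth_index.
Qed.

(** [F] is generated by the coefficients of the multiplier [Poly s]: if [t] carries z into
    [D[X][Y]], then [t * Poly s] carries it into [F[Y]]. *)
Lemma not_Theta_star_poly Q : prime_ideal Q -> ~ Theta star Q ->
  exists F, [/\ fgen F, F `<=` emb Q &
    star_poly star (@base R1) `<=` star_poly star F].
Proof.
move=> pQ nQ; have [s Qs Ss] := not_Theta_Smult pQ nQ; have [iQ _ _] := pQ.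
pose F := generated (@base R1) (map (@FracField.tofrac R1) s).
have sF : submodule (@base R1) F by exact: (generated_submod _ (base_subring R1)).
have Fs i : F (tofrac (Poly s)`_i).
  rewrite coef_Poly; have [lt_i|le_i] := ltnP i (size s).
    by apply: generated_base_mem; apply: map_f; apply: mem_nth.
  by rewrite nth_default // tofrac0; case: sF.
exists F; split.
- split; last by eexists.
  exists (tofrac (lead_coef (Poly s))); first exact: Fs.
  by rewrite tofrac_eq0 lead_coef_eq0 Smult_neq0.
- exact: gen_sub_emb.
- move=> z /star_polyP [t St ht]; apply/star_polyP; exists (t * Poly s).
    exact: SmultM.
  move=> i; rewrite coefM (big_morph _ (@tofracD _) (@tofrac0 _)) mulr_sumr.
  apply: (submod_sum (@base1 _) sF) => j _.
  by rewrite tofracM mulrA; apply: (submodM sF).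
Qed.

Lemma star_primes_star_poly : star_primes (star_poly star) = Theta star.
Proof.
apply/seteqP; split=> Q.
  case=> pQ hQ; apply: contrapT => nQ.
  have [F [fF FQ F1]] := not_Theta_star_poly pQ nQ.
  case: hQ => [Q0|[_ h]]; first by apply: nQ; rewrite Q0; apply: Theta0.
  by apply: h => z /F1 Fz; exists F.
move=> tQ; have /ThetaE [pQ _] := tQ; split=> //.
right; split=> [z [F [fF FQ]]|].
  apply: star_poly_mono => x /FQ [a _ <-]; exact: base_tofrac.
move=> /(_ 1) []; first by apply: star_poly_ext (@base1 _); apply: subring_submod (base_subring _).
by move=> F [fF FQ] /(star_poly_mono FQ); apply: star_poly_Theta.
Qed.

Lemma star_primes_star_poly_finite_type :
  primes_of_finite_type (star_primes (star_poly star)).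
Proof. by rewrite star_primes_star_poly; apply: Theta_finite_type. Qed.

(** For [Q] in [Theta], a multiplier [t] has a coefficient outside [Q]; if [a] times that
    coefficient is in [Q], so is [a]. *)
Lemma QSpec_star_poly Q :
  QSpec (star_poly star) Q <-> Theta star Q /\ nonzero_set Q.
Proof.
split=> [[pQ [iQ nzQ eQ]]|[tQ nzQ]].
  split=> //; apply: contrapT => nQ.
  have [F [fF FQ F1]] := not_Theta_star_poly pQ nQ; have [_ Q1 _] := pQ.
  apply: Q1; rewrite -eQ /preimage /= tofrac1; apply: (star_poly_mono FQ).
  by apply: F1; apply: star_poly_ext (@base1 _); apply: subring_submod (base_subring _).
have /ThetaE [pQ _] := tQ; have [iQ _ hQ] := pQ; split=> //; split=> //.
apply/seteqP; split=> a; last first.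
  by move=> Qa; apply: star_poly_ext; [apply: emb_submod|apply/embE].
case/star_polyP => t /SmultP St h; apply: contrapT => nQa; apply: (St _ tQ) => i.
by have := h i; rewrite -tofracM => /embE /(hQ _ _ I I) [/nQa|].
Qed.

(** A centre outside [Theta] contains an [F] with 1 in its closure, which would force 1 into the
    nonunits. If the centre is in [Theta], every multiplier has a coefficient that is a unit of [V],
    and dividing by it puts z in [F V]. *)
Lemma star_valuation_star_poly V :
  star_valuation_overring (star_poly star) V <->
  valuation_overring V /\ Theta star (@FracField.tofrac R1 @^-1` nonunits V).
Proof.
have center_prime : valuation_overring V ->
    prime_ideal (@FracField.tofrac R1 @^-1` nonunits V).
  move=> [/subringP sV bV hV]; have [[NV sN] N1 hN] := nonunits_prime (conj sV hV).
  have Vt (a : R1) : V (tofrac a) by apply: bV; apply: base_tofrac.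
  split.
  - split=> //; split; first by rewrite /preimage /= tofrac0; case: sN.
    move=> a x y _ Nx Ny; rewrite /preimage /= tofracD tofracM.
    by case: sN => _; apply.
  - by rewrite /preimage /= tofrac1.
  - by move=> a b _ _; rewrite /preimage /= tofracM; apply: hN.
split=> [[vV hV]|[vV tQ]]; split=> //.
  have [/subringP sV bV dV] := vV; have [[NV sN] N1 hN] := nonunits_prime (conj sV dV).
  apply: contrapT => nQ.
  have [F [fF FQ F1]] := not_Theta_star_poly (center_prime vV) nQ.
  apply: N1; have : setmul F V 1.
    apply: hV => //; apply: F1; apply: star_poly_ext (@base1 _).
    exact: subring_submod (base_subring _).
  have V1 : V 1 by case: sV.
  move: (1 : K1); apply: setmul_min; first by case: sN.
    by move=> x y; apply: (submodD V1 sN).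
  by move=> x y /FQ [a Na <-] Vy; rewrite mulrC; apply: (submodM sN).
move=> F fF z /star_polyP [t /SmultP St ht].
have [i nti] : exists i, ~ nonunits V (tofrac t`_i).
  by apply: contrapT => /forallNP h; apply: (St _ tQ) => i; apply: contrapT; apply: h.
have [/subringP sV bV dV] := vV.
have [t0 Vt] : tofrac t`_i != 0 /\ V (tofrac t`_i)^-1.
  have Vti : V (tofrac t`_i) by apply: bV; apply: base_tofrac.
  split; first by apply/eqP => t0; apply: nti; split=> //; left.
  by apply: contrapT => h; apply: nti; split=> //; right.
by rewrite -[z](mulfK t0); apply: setmul_mul.
Qed.

End FiniteType.

(* The chain of the [P_i[X]] is prolonged by [{f | f(0) \in P_m}]. *)
Lemma star_primes_chain_poly (P : nat -> set D) m :
  (forall i, (i <= m)%N -> star_primes star (P i)) ->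
  P 0%N = [set 0] -> (forall i, (i < m)%N -> P i `<` P i.+1) ->
  exists Q : nat -> set R1,
    [/\ forall i, (i <= m.+1)%N -> Theta star (Q i),
        Q 0%N = [set 0] & forall i, (i < m.+1)%N -> Q i `<` Q i.+1].
Proof.
move=> pP P0 ltP.
have pe P' : prime_ideal P' -> prime_ideal (@ext_poly D P').
  move=> pP'; have [[_ sP'] P'1 hP'] := pP'; split.
  - split=> //; split; first by move=> i; rewrite coef0; case: sP'.
    move=> a x y _ P'x P'y; apply: (@ext_polyD _ setT P') => //.
    exact: (@ext_poly_submod _ setT P').
  - by move=> /(_ 0%N); rewrite coef1.
  - by move=> a b _ _; apply: (ext_poly_prime (setT_subring D) pP').
have ce P' : P' 0 -> contraction (@ext_poly D P') = P'.
  move=> P'0; apply/seteqP; split=> a; first by move=> /(_ 0%N); rewrite coefC.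
  by move=> P'a i; rewrite coefC; case: eqP.
have [pm _] := pP m (leqnn _); have [[_ sm] m1 hm] := pm.
exists (fun i => if (i <= m)%N then @ext_poly D (P i) else [set f : R1 | P m f`_0]).
split.
- move=> i; rewrite leq_eqVlt ltnS => /predU1P [->|le_i].
    rewrite ltnn; apply/ThetaE; split.
      split.
      + split=> //; split; first by rewrite /= coef0; case: sm.
        move=> a x y _ /= Px Py; rewrite coefD coef0M.
        by case: sm => _; apply.
      + by rewrite /= coef1.
      + by move=> a b _ _ /=; rewrite coef0M; apply: hm.
    have -> : contraction [set f : R1 | P m f`_0] = P m; last exact: pP.
    by apply/seteqP; split=> a; rewrite /contraction /preimage /= coefC.
  rewrite le_i; have [pi hi] := pP i le_i; apply/ThetaE; split; first exact: pe.
  by rewrite ce //; case: pi => [[_ []]].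
- rewrite /= P0; apply/seteqP; split=> [f f0|_ -> i]; last by rewrite coef0.
  by apply/polyP => i; rewrite coef0; apply: f0.
- move=> i; rewrite ltnS => le_im; rewrite le_im; case: ltngtP le_im => // [lt_im _|-> _].
    have [sub nsub] := ltP i lt_im; split=> [f Pf j|h]; first exact: sub.
    apply: nsub => a Pa; suff : ext_poly (P i) a%:P.
      by move=> /(_ 0%N); rewrite coefC.
    apply: h => j; rewrite coefC; case: eqP => // _.
    by have [[[_ [h0 _]] _ _] _] := pP i.+1 lt_im.
  split=> [f|]; first exact.
  move=> /(_ 'X) h; apply: m1.
  suff : ext_poly (P m) ('X : R1) by move=> /(_ 1%N); rewrite coefX.
  by apply: h; rewrite /= coefX; case: sm.
Qed.

End PolynomialSemistar.

(** * Extensions of transcendence degree one *)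

Section TranscendenceDegreeOne.
Variables (L F : fieldType) (phi : {rmorphism L -> F}) (V : set F).
Hypothesis vV : valuation_ring V.
Implicit Types (x y t u : F) (p q : set F).

Let sV : subring V. Proof. by case: vV. Qed.
Let V1 : V 1. Proof. by case: sV. Qed.

(** Equality of values for nonzero arguments. As 0 / y and y / 0 are 0, it holds whenever an
    argument is 0; hence the nonzero hypotheses below. *)
Definition same_value x y : Prop := V (x / y) /\ V (y / x).

Lemma same_value_trans x y z : y != 0 ->
  same_value x y -> same_value y z -> same_value x z.
Proof.
move=> y0 [xy yx] [yz zy]; split.
  have -> : x / z = x / y * (y / z) by rewrite mulrA divfK.
  exact: subringM.
have -> : z / x = z / y * (y / x) by rewrite mulrA divfK.
exact: subringM.
Qed.

(** When a / b is a nonunit, a / b + 1 is a unit, so a + b has the value of b. *)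
Lemma same_valueD x y : x != 0 -> y != 0 -> ~ same_value x y ->
  x + y != 0 /\ (same_value (x + y) x \/ same_value (x + y) y).
Proof.
have main a b : a != 0 -> b != 0 -> V (a / b) -> ~ V (b / a) ->
    a + b != 0 /\ same_value (a + b) b.
  move=> a0 b0 Vab nVba; have [[NV sN] N1 _] := nonunits_prime vV.
  have Nab : nonunits V (a / b) by split=> //; right; rewrite invf_div.
  have e : (a + b) / b = a / b + 1 by rewrite mulrDl divff.
  have n1 : ~ nonunits V (a / b + 1).
    move=> h; apply: N1; have -> : 1 = (a / b + 1) + - (a / b) by rewrite addrC addKr.
    exact: (submodD V1 sN) h (submodN sV sN Nab).
  have Vs : V (a / b + 1) by apply: subringD.
  have s0 : a / b + 1 != 0.
    by apply/eqP => s0; apply: n1; split=> //; left.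
  split.
    apply: contra_neq s0 => ab0; by rewrite -e ab0 mul0r.
  split; first by rewrite e.
  have -> : b / (a + b) = (a / b + 1)^-1 by rewrite -e invf_div.
  by apply: contrapT => h; apply: n1; split=> //; right.
move=> x0 y0 nxy; have [_ hV] := vV.
have [Vxy|] := hV (x / y) (mulf_neq0 x0 (invr_neq0 y0)).
  have [|xy0 h] := main x y x0 y0 Vxy; first by move=> Vyx; apply: nxy.
  by split=> //; right.
rewrite invf_div => Vyx.
have [|xy0 h] := main y x y0 x0 Vyx; first by move=> Vxy; apply: nxy.
by rewrite addrC; split=> //; left.
Qed.

Lemma sum_distinct_values_neq0 (I : eqType) (r : seq I) (f : I -> F) :
  uniq r -> r != [::] -> (forall i, i \in r -> f i != 0) ->
  (forall i j, i \in r -> j \in r -> i != j -> ~ same_value (f i) (f j)) ->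
  \sum_(i <- r) f i != 0 /\
  exists2 i, i \in r & same_value (\sum_(i <- r) f i) (f i).
Proof.
elim: r => // i r IH /= /andP [nir ur] _ f0 df.
rewrite big_cons; have fi0 := f0 i (mem_head _ _).
have [->|r0] := eqVneq r [::].
  rewrite big_nil addr0; split=> //; exists i; first by rewrite inE.
  by rewrite /same_value divff.
have [||||S0 [j jr Sj]] := IH => //.
- by move=> j jr; apply: f0; rewrite inE jr orbT.
- by move=> j k jr kr; apply: df; rewrite inE ?jr ?kr orbT.
have neq_ij : i != j by apply: contraNneq nir => ->.
have [|h0 h] := same_valueD fi0 S0.
  move=> h; apply: (df i j) => //; rewrite ?inE ?eqxx ?jr ?orbT //.
  exact: same_value_trans Sj.
split=> //; case: h => h; first by exists i; rewrite // inE eqxx.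
by exists j; [rewrite inE jr orbT|apply: same_value_trans Sj].
Qed.

(** The units of the localization of [V] at [p]: the elements with value in the convex subgroup
    attached to [p]. A smaller prime has a larger group. *)
Definition local_units p : set F :=
  [set x | exists y z, [/\ V y, V z, ~ p y, ~ p z & x = y / z]].

Section LocalUnits.
Variable p : set F.
Hypothesis pp : prime_ideal_of V p.

Let nz x : ~ p x -> x != 0.
Proof. by move=> npx; apply/eqP => x0; apply: npx; rewrite x0; case: pp => [[_ []]]. Qed.

Lemma local_unitsP x : V x -> (local_units p x <-> ~ p x).
Proof.
move=> Vx; have [[pV sp] p1 hp] := pp; split=> [[y [z [Vy Vz ny nnz e]]] px|npx].
  by apply: ny; rewrite -(divfK (nz nnz) y) -e mulrC; apply: (submodM sp).
by exists x, 1; rewrite divr1.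
Qed.

Lemma local_unitsV x : local_units p x -> local_units p x^-1.
Proof. by case=> y [z [Vy Vz ny nnz ->]]; exists z, y; rewrite invf_div. Qed.

Lemma local_unitsM x y : local_units p x -> local_units p y -> local_units p (x * y).
Proof.
have [_ _ hp] := pp.
case=> a [b [Va Vb na nb ->]] [c [d [Vc Vd nc nd ->]]]; exists (a * c), (b * d).
by split; rewrite ?mulf_div //; [exact: subringM|exact: subringM|case/hp|case/hp].
Qed.

Lemma local_unitsX x n : local_units p x -> local_units p (x ^+ n).
Proof.
move=> px; elim: n => [|n IH]; last by rewrite exprS; apply: local_unitsM.
by rewrite expr0; apply/local_unitsP => //; case: pp.
Qed.

Lemma local_units_div x y : local_units p y -> local_units p (x * y) -> local_units p x.
Proof.
move=> py pxy; have y0 : y != 0.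
  case: py => a [b [_ _ na nb ->]]; by rewrite mulf_neq0 ?invr_neq0 ?nz.
by rewrite -(mulfK y0 x); apply: local_unitsM => //; apply: local_unitsV.
Qed.

Lemma same_value_local_units x y : y != 0 -> x != 0 -> same_value x y -> local_units p (x / y).
Proof.
move=> y0 x0 [Vxy Vyx]; apply/local_unitsP => // h.
have [[_ sp] p1 _] := pp; apply: p1.
have -> : 1 = (y / x) * (x / y) by rewrite -invf_div mulVf ?mulf_neq0 ?invr_neq0.
exact: (submodM sp).
Qed.

End LocalUnits.

Lemma local_units_sub p q : p `<=` q -> local_units q `<=` local_units p.
Proof.
move=> pq x [y [z [Vy Vz ny nnz ->]]]; exists y, z; split=> //.
  by move=> /pq.
by move=> /pq.
Qed.

(* In terms of value groups: when [p] and [q] have the same contraction to [L],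
   no value of [L] lies in the class of a nonzero multiple of the value of [t]
   modulo the convex subgroup of [q]. *)
Lemma flat_jump p q t (a : L) n : prime_ideal_of V p -> prime_ideal_of V q ->
  p `<=` q -> (forall b, q (phi b) -> p (phi b)) -> q t -> ~ p t ->
  a != 0 -> (0 < n)%N -> ~ local_units q (phi a * t ^+ n).
Proof.
move=> pp pq sub flat qt npt a0 n0 h.
have [[qV sq] q1 hq] := pq; have Vt := qV _ qt.
have pa : local_units p (phi a).
  apply: (local_units_div pp (y := t ^+ n)); last exact: local_units_sub h.
  by apply: local_unitsX => //; apply/local_unitsP.
(* Flatness enters here: elements of [L] cannot distinguish the subgroups of [p] and [q]. *)
have up b : V (phi b) -> local_units p (phi b) -> local_units q (phi b).
  by move=> Vb /(local_unitsP pp Vb) npb; apply/local_unitsP => // /flat.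
have qa : local_units q (phi a).
  have [_ hV] := vV; have pa0 : phi a != 0 by rewrite fmorph_eq0.
  have [Va|Va] := hV _ pa0.
    exact: up.
  rewrite -fmorphV in Va.
  rewrite -[phi a]invrK -fmorphV; apply: local_unitsV; apply: up => //.
  by rewrite fmorphV; apply: local_unitsV.
have : local_units q (t ^+ n).
  by apply: (local_units_div pq qa); rewrite mulrC.
move/(local_unitsP pq (subringX n sV Vt)); apply.
by rewrite -(prednK n0) exprS mulrC; apply: (submodM sq) => //; apply: subringX.
Qed.

Hypothesis algebraic_dependence : forall t u : F,
  exists N (c : 'I_N * 'I_N -> L), (exists i, c i != 0) /\
    \sum_i phi (c i) * (t ^+ i.1 * u ^+ i.2) = 0.

(* Two flat jumps, at [t] and at [u], would make the values of the monomials
   [t ^ k * u ^ l] independent modulo the values of [L]. *)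
Lemma flat_jump_unique p q p' q' :
  prime_ideal_of V p -> prime_ideal_of V q ->
  prime_ideal_of V p' -> prime_ideal_of V q' ->
  p `<` q -> q `<=` p' -> p' `<` q' ->
  (forall b, q (phi b) -> p (phi b)) -> ~ (forall b, q' (phi b) -> p' (phi b)).
Proof.
move=> pp pq pp' pq' [pq_sub /existsNP [t /not_implyP [qt npt]]] qp'.
move=> [pq'_sub /existsNP [u /not_implyP [qu npu]]] flat flat'.
have nz r x : prime_ideal_of V r -> ~ r x -> x != 0.
  by move=> pr nrx; apply/eqP => x0; apply: nrx; rewrite x0; case: pr => [[_ []]].
have t0 := nz _ _ pp npt; have u0 := nz _ _ pp' npu.
have Vu : V u by have [[h _] _ _] := pq'; apply: h.
have [N [c [[i0 ci0] S0]]] := algebraic_dependence t u.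
pose f (i : 'I_N * 'I_N) := phi (c i) * (t ^+ i.1 * u ^+ i.2).
have f0 i : c i != 0 -> f i != 0.
  by move=> ci; rewrite !mulf_neq0 ?fmorph_eq0 ?expf_neq0.
(* For different powers of [t], compare at the lower jump: [u] is outside [p'], hence outside [q],
   and its powers are local units there. *)
have dist1 i j : c i != 0 -> c j != 0 -> (j.1 < i.1)%N -> ~ same_value (f i) (f j).
  move=> ci cj ltji /(same_value_local_units pq (f0 _ cj) (f0 _ ci)) h.
  have qu' : local_units q u by apply/local_unitsP => // /qp'.
  apply: (flat_jump pp pq pq_sub flat qt npt (a := c i / c j) (n := i.1 - j.1)).
  - by rewrite mulf_neq0 ?invr_neq0.
  - by rewrite subn_gt0.
  have -> : phi (c i / c j) * t ^+ (i.1 - j.1) = f i / f j * (u ^+ j.2 * (u ^+ i.2)^-1).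
    rewrite /f -{2}(subnK (ltnW ltji)) exprD rmorphM fmorphV /=.
    by field; rewrite fmorph_eq0 cj !expf_neq0.
  apply: local_unitsM => //; apply: local_unitsM => //; first exact: local_unitsX.
  by apply: local_unitsV; apply: local_unitsX.
(* For equal powers of [t] these cancel, and the upper jump separates the powers of [u]. *)
have dist2 i j : c i != 0 -> c j != 0 -> i.1 = j.1 -> (j.2 < i.2)%N ->
    ~ same_value (f i) (f j).
  move=> ci cj eij ltji /(same_value_local_units pq' (f0 _ cj) (f0 _ ci)) h.
  apply: (flat_jump pp' pq' pq'_sub flat' qu npu (a := c i / c j) (n := i.2 - j.2)).
  - by rewrite mulf_neq0 ?invr_neq0.
  - by rewrite subn_gt0.
  suff -> : phi (c i / c j) * u ^+ (i.2 - j.2) = f i / f j by [].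
  rewrite /f eij -{2}(subnK (ltnW ltji)) exprD rmorphM fmorphV /=.
  by field; rewrite fmorph_eq0 cj !expf_neq0.
have sym x y : same_value x y -> same_value y x by case.
have [||||+ _] := @sum_distinct_values_neq0 _
    [seq i <- index_enum ('I_N * 'I_N)%type | c i != 0] f.
- by rewrite filter_uniq ?index_enum_uniq.
- by rewrite -has_filter; apply/hasP; exists i0 => //; apply: mem_index_enum.
- by move=> i; rewrite mem_filter => /andP [/f0].
- move=> i j; rewrite !mem_filter => /andP [ci _] /andP [cj _] neq_ij.
  have [lt1|lt1|e1] := ltngtP i.1 j.1.
  + by move=> /sym; apply: dist1.
  + exact: dist1.
  + have e1' : i.1 = j.1 by apply: val_inj.
    have [lt2|lt2|e2] := ltngtP i.2 j.2.
    * by move=> /sym; apply: dist2.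
    * exact: dist2.
    * have e2' : i.2 = j.2 by apply: val_inj.
      by case/eqP: neq_ij; case: i j e1' e2' {ci cj e1 e2} => [? ?] [? ?] /= -> ->.
rewrite big_filter big_mkcond /= (eq_bigr f) ?S0 ?eqxx //.
by move=> i _; case: eqP => //= ci; rewrite /f ci rmorph0 mul0r.
Qed.

Lemma prime_chain_preimage (p : nat -> set F) m :
  (forall i, (i <= m.+1)%N -> prime_ideal_of V (p i)) ->
  (forall i, (i < m.+1)%N -> p i `<` p i.+1) ->
  exists q : nat -> set L,
    (forall i, (i <= m)%N -> prime_ideal_of (phi @^-1` V) (q i)) /\
    (forall i, (i < m)%N -> q i `<` q i.+1).
Proof.
move=> pp ltp.
have pq i : (i <= m.+1)%N -> prime_ideal_of (phi @^-1` V) (phi @^-1` p i).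
  move=> /pp [[pV [p0 sp]] p1 hp]; split.
  - split; first by move=> x /pV.
    split; first by rewrite /preimage /= rmorph0.
    by move=> a x y Va px py; rewrite /preimage /= rmorphD rmorphM; apply: sp.
  - by rewrite /preimage /= rmorph1.
  - by move=> a b Va Vb; rewrite /preimage /= rmorphM; apply: hp.
pose flat i := forall b, p i.+1 (phi b) -> p i (phi b).
have leq i : (i < m.+1)%N -> phi @^-1` p i `<=` phi @^-1` p i.+1.
  by move=> /ltp [sub _] x; apply: sub.
have ltq i : (i < m.+1)%N -> ~ flat i -> phi @^-1` p i `<` phi @^-1` p i.+1.
  by move=> lt_i nf; split; [apply: leq|move=> h; apply: nf].
have lep i j : (i <= j)%N -> (j <= m.+1)%N -> p i `<=` p j.
  move=> le_ij; rewrite -(subnKC le_ij); elim: (j - i)%N => [|k IH] le_k.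
    by rewrite addn0.
  rewrite addnS; rewrite addnS in le_k; apply: (subset_trans (IH (ltnW le_k))).
  by case: (ltp (i + k)%N).
have uniq_flat i j : (i < j)%N -> (j < m.+1)%N -> flat i -> ~ flat j.
  move=> lt_ij lt_j; have lt_i := ltn_trans lt_ij lt_j.
  apply: flat_jump_unique; try exact: ltp; try (by apply: pp => //; exact: ltnW).
    exact: lep (ltnW lt_j).
have [[i [lt_i fi]]|nf] := pselect (exists i, (i < m.+1)%N /\ flat i); last first.
  exists (fun i => phi @^-1` p i); split=> i lt_i; first exact/pq/leqW.
  by apply: ltq; [apply: leqW|move=> fi; apply: nf; exists i; split=> //; apply: leqW].
(* The omitted prime is [p i.+1], which has the same contraction as [p i]. *)
exists (fun j => if (j <= i)%N then phi @^-1` p j else phi @^-1` p j.+1); split=> j lt_j.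
  by case: ifP => _; apply: pq => //; apply: leqW.
have lt_j' : (j < m.+1)%N by apply: leqW.
case: (ltngtP j i) => [lt_ji|lt_ij|e].
- by apply: ltq => // /(uniq_flat _ _ lt_ji lt_i).
- by apply: ltq => //; apply: uniq_flat fi => //; apply: leqW.
- rewrite e in lt_j lt_j' *.
  have [sub nsub] : phi @^-1` p i.+1 `<` phi @^-1` p i.+2.
    by apply: ltq => //; apply: uniq_flat fi.
  split; first by apply: subset_trans sub; apply: leq.
  by move=> h; apply: nsub; apply: (subset_trans h); apply: leq.
Qed.

End TranscendenceDegreeOne.

(** * The extension of [K] by one variable *)

Section FractionExtension.
Variable A : idomainType.
Local Notation L := {fraction A}.
Local Notation F := {fraction {poly A}}.

(** The inclusion of [K] in [K(X)], through a chosen numerator and denominator; [frac_polyCE] gives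
    the independence of the choice. *)
Definition frac_polyC (x : L) : F :=
  let ab := sval (cid (fracP x)) in
  tofrac ab%:P / tofrac (sval (cid (svalP (cid (fracP x)))))%:P.

Lemma frac_polyCE (a b : A) : b != 0 ->
  frac_polyC (tofrac a / tofrac b) = tofrac a%:P / tofrac b%:P.
Proof.
move=> b0; rewrite /frac_polyC; set h := svalP _; case: (cid h) => d /= [d0].
set c := sval _ => e; apply/eqP; rewrite eqr_div ?tofrac_eq0 ?polyC_eq0 //.
move/eqP: e; rewrite eqr_div ?tofrac_eq0 // -2!tofracM tofrac_eq => /eqP e.
by rewrite -2!tofracM -2!polyCM e.
Qed.

Lemma frac_polyC_tofrac (a : A) : frac_polyC (tofrac a) = tofrac a%:P.
Proof.
by rewrite -[tofrac a]divr1 -tofrac1 frac_polyCE ?oner_neq0 // polyC1 tofrac1 divr1.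
Qed.

Lemma frac_polyC_is_zmod_morphism : zmod_morphism frac_polyC.
Proof.
move=> x y; have [a [b [b0 ->]]] := fracP x; have [c [d [d0 ->]]] := fracP y.
have e (R : idomainType) (p q r s : R) : q != 0 -> s != 0 ->
    tofrac p / tofrac q - tofrac r / tofrac s =
    tofrac (p * s - r * q) / tofrac (q * s).
  move=> q0 s0; rewrite -mulNr addf_div ?tofrac_eq0 //.
  by rewrite tofracB 3!tofracM mulNr.
rewrite e // !frac_polyCE ?mulf_neq0 // e ?polyC_eq0 //.
by rewrite polyCB 3!polyCM.
Qed.

Lemma frac_polyC_is_monoid_morphism : monoid_morphism frac_polyC.
Proof.
split; first by rewrite -tofrac1 frac_polyC_tofrac polyC1 tofrac1.
move=> x y; have [a [b [b0 ->]]] := fracP x; have [c [d [d0 ->]]] := fracP y.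
rewrite mulf_div -2!tofracM !frac_polyCE ?mulf_neq0 // 2!polyCM 2!tofracM.
by rewrite mulf_div.
Qed.

HB.instance Definition _ := GRing.isZmodMorphism.Build L F frac_polyC
  frac_polyC_is_zmod_morphism.
HB.instance Definition _ := GRing.isMonoidMorphism.Build L F frac_polyC
  frac_polyC_is_monoid_morphism.

(** The coefficient matrix has more rows than columns, so its left kernel is nonzero. *)
Lemma poly_linear_dependence (I : finType) (f : I -> {poly A}) n :
  (forall i, size (f i) <= n)%N -> (n < #|I|)%N ->
  exists v : I -> L, (exists i, v i != 0) /\
    \sum_i frac_polyC (v i) * tofrac (f i) = 0.
Proof.
move=> szf lt_n.
pose M := \matrix_(i < #|I|, j < n) (tofrac (f (enum_val i))`_j : L).
have /rowV0Pn [w /sub_kermxP wM w0] : kermx M != 0.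
  rewrite -mxrank_eq0 mxrank_ker subn_eq0 -ltnNge.
  exact: leq_ltn_trans (rank_leq_col M) lt_n.
exists (fun i => w 0 (enum_rank i)); split.
  apply: contrapT => /forallNP h; case/eqP: w0; apply/rowP => j.
  rewrite mxE -(enum_valK j); apply: contrapT => /eqP; exact: h.
have ef i : tofrac (f i) = \sum_(j < n) frac_polyC (tofrac (f i)`_j) * tofrac 'X^j.
  have {1}-> : f i = \poly_(j < n) (f i)`_j.
    apply/polyP => j; rewrite coef_poly; case: ltnP => // le_j.
    by rewrite nth_default // (leq_trans (szf i)).
  rewrite poly_def (big_morph _ (@tofracD _) (@tofrac0 _)); apply: eq_bigr => j _.
  by rewrite -mul_polyC tofracM frac_polyC_tofrac.
transitivity (\sum_(j < n) frac_polyC (\sum_i w 0 (enum_rank i) * tofrac (f i)`_j)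
              * tofrac 'X^j : F).
  rewrite (eq_bigr _ (fun i _ => congr1 _ (ef i))).
  rewrite (eq_bigr _ (fun i _ => mulr_sumr _ _ _ _)) exchange_big /=.
  apply: eq_bigr => j _; rewrite rmorph_sum mulr_suml; apply: eq_bigr => i _.
  by rewrite rmorphM mulrA.
rewrite big1 // => j _; have := congr1 (fun v : 'rV_n => v 0 j) wM; rewrite !mxE => e.
suff -> : \sum_i w 0 (enum_rank i) * tofrac (f i)`_j = 0 by rewrite rmorph0 mul0r.
rewrite -[RHS]e (reindex _ (onW_bij _ (@enum_val_bij I))) /=.
by apply: eq_bigr => i _; rewrite mxE enum_valK.
Qed.

Lemma size_mulX_leq (p q : {poly A}) d k l : (size p <= d.+1)%N -> (size q <= d.+1)%N ->
  (size (p ^+ k * q ^+ l)%R <= (k + l) * d + 1)%N.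
Proof.
have sz (r : {poly A}) j : (size r <= d.+1)%N -> (size (r ^+ j)%R <= j * d + 1)%N.
  move=> szr; rewrite addn1; apply: leq_trans (size_exp_leq _ _) _.
  by rewrite ltnS mulnC leq_mul2l -subn1 leq_subLR add1n szr orbT.
move=> szp szq; have hp := sz _ k szp; have hq := sz _ l szq; apply: leq_trans (size_polyMleq _ _) _.
by rewrite mulnDl; lia.
Qed.

Lemma frac_expM_denom (R : idomainType) (x y : R) k n : y != 0 -> (k <= n)%N ->
  (tofrac x / tofrac y) ^+ k * tofrac (y ^+ n) = tofrac (x ^+ k * y ^+ (n - k)).
Proof.
move=> y0 le_k; have ty0 : tofrac y ^+ k != 0 by rewrite expf_neq0 ?tofrac_eq0.
rewrite expr_div_n tofracM 3!tofracXn -{1}(subnKC le_k) exprD.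
by rewrite mulrA divfK.
Qed.

(* Over the common denominator, the [N ^ 2] monomials [t ^ k * u ^ l] become
   polynomials of degree [O(N)]. *)
Lemma frac_poly_algebraic_dependence (t u : F) :
  exists N (c : 'I_N * 'I_N -> L), (exists i, c i != 0) /\
    \sum_i frac_polyC (c i) * (t ^+ i.1 * u ^+ i.2) = 0.
Proof.
have [a [b [b0 et]]] := fracP t; have [c [e [e0 eu]]] := fracP u.
pose d := (size a + size b + size c + size e).+1.
have [ha hb hc he] : [/\ size a <= d.+1, size b <= d.+1, size c <= d.+1 & size e <= d.+1]%N.
  by rewrite /d; split; lia.
(* The number of monomials is (2d + 1)^2 = 4d^2 + 4d + 1, and their sizes are at most 2Nd + 1 = 4d^2
   + 1; [d] is positive by its definition. *)
pose N := (2 * d)%N.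
pose f (i : 'I_N.+1 * 'I_N.+1) : {poly A} :=
  (a ^+ i.1 * b ^+ (N - i.1)) * (c ^+ i.2 * e ^+ (N - i.2)).
have szf i : (size (f i) <= (N + N) * d + 1)%N.
  apply: leq_trans (size_polyMleq _ _) _.
  have := size_mulX_leq i.2 (N - i.2) hc he.
  have := size_mulX_leq i.1 (N - i.1) ha hb.
  have [le1 le2] : (i.1 <= N)%N /\ (i.2 <= N)%N by split; rewrite -ltnS.
  rewrite !subnKC // mulnDl.
  by move: (size _) (size _) (N * d)%N => x y z; lia.
have [|v [v0 S0]] := poly_linear_dependence szf.
  by rewrite card_prod card_ord /N /d; nia.
exists N.+1, v; split=> //.
have nz : tofrac (b ^+ N * e ^+ N) != 0 :> F by rewrite tofrac_eq0 mulf_neq0 ?expf_neq0.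
apply: (mulIf nz); rewrite mul0r -[RHS]S0 mulr_suml; apply: eq_bigr => i _.
rewrite -mulrA; congr (_ * _).
have [le1 le2] : (i.1 <= N)%N /\ (i.2 <= N)%N by split; rewrite -ltnS.
rewrite tofracM mulrACA et eu.
rewrite (frac_expM_denom a b0 le1) (frac_expM_denom c e0 le2).
by rewrite -tofracM.
Qed.

Lemma valuation_overring_frac_poly (V : set F) : valuation_overring V ->
  valuation_overring (frac_polyC @^-1` V).
Proof.
case=> /subringP [V1 VB VM] bV hV; split.
- apply/subringP; split; first by rewrite /preimage /= rmorph1.
    by move=> x y; rewrite /preimage /= rmorphB; apply: VB.
  by move=> x y; rewrite /preimage /= rmorphM; apply: VM.
- move=> _ [a _ <-]; rewrite /preimage /= frac_polyC_tofrac.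
  by apply: bV; apply: base_tofrac.
- by move=> x x0; rewrite /preimage /= fmorphV; apply: hV; rewrite fmorph_eq0.
Qed.

Lemma center_frac_poly (V : set F) :
  @FracField.tofrac A @^-1` nonunits (frac_polyC @^-1` V) =
  contraction (@FracField.tofrac {poly A} @^-1` nonunits V).
Proof.
have z (a : A) : tofrac a = 0 <-> tofrac a%:P = 0 :> F.
  by split=> /eqP; rewrite !tofrac_eq0 ?polyC_eq0 => /eqP ->; rewrite ?polyC0 tofrac0.
have vE (a : A) : frac_polyC (tofrac a)^-1 = (tofrac a%:P)^-1.
  by rewrite fmorphV /= frac_polyC_tofrac.
apply/seteqP; split=> a; rewrite /contraction /nonunits /preimage /= vE.
  rewrite frac_polyC_tofrac => -[Va [/z a0|nVa]]; split=> //.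
    by left.
  by right.
rewrite frac_polyC_tofrac => -[Va [/z a0|nVa]]; split=> //.
  by left.
by right.
Qed.

Lemma krull_chain_frac_poly (V : set F) m : valuation_overring V ->
  krull_chain V m.+1 -> krull_chain (frac_polyC @^-1` V) m.
Proof.
case=> /subringP sV _ dV [p [pp ltp]].
exact: (@prime_chain_preimage _ _ frac_polyC _ (conj sV dV)
         frac_poly_algebraic_dependence p m pp ltp).
Qed.

End FractionExtension.

(** * Dimensions *)

Definition centered (D : idomainType) (G : set (set D)) (V : set {fraction D}) : Prop :=
  valuation_overring V /\ G (@FracField.tofrac D @^-1` nonunits V).

Definition chain_from0 (D : idomainType) (G : set (set D)) (m : nat) : Prop :=
  exists P : nat -> set D,
    [/\ forall i, (i <= m)%N -> G (P i), P 0%N = [set 0] &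
        forall i, (i < m)%N -> P i `<` P i.+1].

Section Chains.
Variable D : idomainType.
Local Notation K := {fraction D}.
Implicit Types (star : set K -> set K) (G : set (set D)) (V : set K).

Lemma star_chainE star G m : (forall P, G P -> prime_ideal P) -> G [set 0] ->
  (forall P, QSpec star P <-> G P /\ nonzero_set P) ->
  star_chain star m <-> chain_from0 G m.
Proof.
move=> pG G0 hG; split=> [[P [P0 hP]]|[P [GP P0 ltP]]]; exists P.
  split=> // i; last by case/hP.
  by case: i => [_|i /hP [_ /hG []]] //; rewrite P0.
split=> // i lt_i; split; first exact: ltP.
apply/hG; split; first exact: GP.
have [sub /existsNP [x /not_implyP [Px nPx]]] := ltP i lt_i.
exists x => //; apply/eqP => x0; apply: nPx; rewrite x0.
by have [[_ []]] := pG _ (GP i (ltnW lt_i)).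
Qed.

Lemma chain_from0_valuation G m : (forall P, G P -> prime_ideal P) ->
  chain_from0 G m -> exists2 V, centered G V & krull_chain V m.
Proof.
move=> pG [P [GP P0 ltP]].
have sB := base_subring D.
have pe i : (i <= m)%N -> prime_ideal_of (@base D) (emb (P i)).
  move=> /GP/pG [iP P1 hP]; split.
  - split; last exact: emb_submod.
    by move=> _ [a _ <-]; apply: base_tofrac.
  - by rewrite -tofrac1 => /embE.
  - move=> _ _ [a _ <-] [b _ <-]; rewrite -tofracM => /embE /(hP _ _ I I) [h|h].
      by left; apply/embE.
    by right; apply/embE.
have lte i : (i < m)%N -> emb (P i) `<` emb (P i.+1).
  move=> /ltP [sub nsub]; split; first exact: image_subset.
  by move=> h; apply: nsub => a Pa; apply/embE; apply: h; apply/embE.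
have [V [p [vV BV pmV pV incp]]] := lift_prime_chain sB pe lte.
have [sV dV] := vV.
exists V.
  split; first by split=> //; apply/subringP.
  have -> : @FracField.tofrac D @^-1` nonunits V = P m; last exact: GP.
  apply/seteqP; split=> a; rewrite /preimage /= -pmV.
    by move=> /(pV m (leqnn _)).2 h; apply/embE; apply: h; apply: base_tofrac.
  by move=> Pa; apply/(pV m (leqnn _)).2; [apply: base_tofrac|apply/embE].
exists p; split=> i lt_i; first by case: (pV i lt_i).
split; first exact: incp.
(* The lifting only gives weak inclusions; strictness is inherited from the distinct contractions to
   [D]. *)
have [_ nsub] := lte i lt_i => h; apply: nsub => x ex.
have [[eB _] _ _] := pe i.+1 lt_i; have Bx := eB _ ex.
by apply/(pV i (ltnW lt_i)).2 => //; apply: h; apply/(pV i.+1 lt_i).2.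
Qed.

End Chains.

(** * Prime chains over a quasi-Pruefer base *)

Section BaseStep.
Variable D : idomainType.
Local Notation K := {fraction D}.
Variable star : set K -> set K.
Hypotheses (hstar : semistar star) (qP : quasi_prufer (star_tilde star)).

(** The kernel of evaluation at t = a / b contracts to 0 in [D]. Were it inside [P[X]],
    quasi-Pruefer would make it zero; but it contains bX - a. *)
Lemma eval_kernel_not_ext (t : K) P : star_primes star P ->
  exists2 f : {poly D}, (map_poly (@FracField.tofrac D) f).[t] = 0 & ~ ext_poly P f.
Proof.
move=> GP; pose Q := [set f : {poly D} | (map_poly (@FracField.tofrac D) f).[t] = 0].
have pQ : prime_ideal_of setT Q.
  split.
  - split=> //; split; first by rewrite /Q /= rmorph0 horner0.
    move=> f g h _; rewrite /Q /= => g0 h0.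
    by rewrite rmorphD rmorphM hornerD hornerM g0 h0 mulr0 addr0.
  - by rewrite /Q /= rmorph1 hornerC => /eqP; rewrite oner_eq0.
  - move=> f g _ _; rewrite /Q /= rmorphM hornerM => /eqP.
    by rewrite mulf_eq0 => /orP [] /eqP; [left|right].
have cQ (a : D) : Q a%:P -> a = 0.
  by rewrite /Q /= map_polyC hornerC /= => /eqP; rewrite tofrac_eq0 => /eqP.
have [a [b [b0 et]]] := fracP t.
have Qab : Q (b *: 'X - a%:P).
  rewrite /Q /= rmorphB /= map_polyZ map_polyX map_polyC /=.
  by rewrite hornerD hornerN hornerZ hornerX hornerC et mulrC divfK ?subrr // tofrac_eq0.
have f0 : b *: 'X - a%:P != 0.
  apply/eqP => /polyP /(_ 1%N); rewrite coefB coefZ coefX coefC /= mulr1 subr0 coef0.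
  by move/eqP: b0.
apply: contrapT => h.
have QP : Q `<=` ext_poly P.
  by move=> f Qf; apply: contrapT => nf; apply: h; exists f.
have [pP _] := GP; have [iP _ _] := pP.
have [P0|nP0] := pselect (P = [set 0]).
  by case/eqP: f0; apply/polyP => i; rewrite coef0; have := QP _ Qab i; rewrite P0.
have eQ : Q = ext_poly (contraction Q).
  apply: qP => //; exists P => //; apply/(QSpec_star_tilde hstar).
  by split=> //; apply: ideal_nonzero.
move: Qab; rewrite eQ => Qab; case/eqP: f0; apply/polyP => i; rewrite coef0.
by apply: cQ; apply: Qab.
Qed.

(* Incomparability over the quasi-Pruefer base: a relation [f(t) = 0] with a
   coefficient outside the common contraction, cut at the first such
   coefficient, would put a unit of the localization at [q] into [p]. *)
Lemma contraction_strict (W p q : set K) : valuation_overring W ->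
  prime_ideal_of W p -> prime_ideal_of W q -> p `<` q ->
  star_primes star (@FracField.tofrac D @^-1` q) ->
  @FracField.tofrac D @^-1` p `<` @FracField.tofrac D @^-1` q.
Proof.
move=> [/subringP sW bW _] [[pW sp] p1 hp] [[qW sq] q1 hq].
move=> [pq /existsNP [t /not_implyP [qt npt]]] Gq.
split=> [a|sub]; first exact: pq.
have [f ft nf] := eval_kernel_not_ext t Gq.
have [W1 _ _] := sW; have Wt := qW _ qt.
have ex : exists i, ~~ `[< q (tofrac f`_i) >].
  by move/existsNP: nf => [i hi]; exists i; apply/asboolPn.
case: (ex_minnP ex) => i /asboolPn qi mini.
have Wev (g : {poly D}) : W (map_poly (@FracField.tofrac D) g).[t].
  rewrite horner_coef; apply: subring_sum => // j _.
  apply: subringM => //; last exact: subringX.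
  by rewrite coef_map; apply: bW; apply: base_tofrac.
have p_lo : p (map_poly (@FracField.tofrac D) (take_poly i f)).[t].
  rewrite horner_coef; apply: (submod_sum W1 sp) => j _.
  rewrite mulrC; apply: (submodM sp); first exact: subringX.
  rewrite coef_map coef_take_poly /=; case: ltnP => lt_ji; last first.
    by rewrite tofrac0; case: sp.
  apply: sub; apply: contrapT => /asboolPn/mini.
  by rewrite leqNgt lt_ji.
have e_hi : (map_poly (@FracField.tofrac D) (drop_poly i f)).[t] =
    tofrac f`_i + t * (map_poly (@FracField.tofrac D) (drop_poly i.+1 f)).[t].
  have -> : drop_poly i f = (f`_i)%:P + 'X * drop_poly i.+1 f.
    apply/polyP => j; rewrite coefD coefC coefXM !coef_drop_poly.
    by case: j => [|j] /=; rewrite ?add0n ?addr0 ?add0r // addnS addSn.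
  rewrite rmorphD rmorphM /= map_polyC map_polyX /=.
  by rewrite hornerD hornerC hornerM hornerX.
(* Since [t] is outside [p], the upper part of [f] has value in [p], hence in [q]; as [t] is in [q],
   its constant term f_i would be in [q]. *)
have : p (t ^+ i * (map_poly (@FracField.tofrac D) (drop_poly i f)).[t]).
  have e : (map_poly (@FracField.tofrac D) (take_poly i f)).[t]
      + t ^+ i * (map_poly (@FracField.tofrac D) (drop_poly i f)).[t] = 0.
    rewrite -[RHS]ft -[f in RHS](poly_take_drop i) rmorphD rmorphM /= map_polyXn.
    by rewrite hornerD hornerM hornerXn mulrC.
  by move/eqP: e; rewrite addrC addr_eq0 => /eqP ->; apply: (submodN sW sp).
case/hp; [exact: subringX|exact: Wev| |].
  by move=> /(prime_idealX sW (And3 (conj pW sp) p1 hp) Wt).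
rewrite e_hi => /pq h; apply: qi.
rewrite -(addrK (t * (map_poly (@FracField.tofrac D) (drop_poly i.+1 f)).[t]) (tofrac _)).
apply: (submodD W1 sq) h _; apply: (submodN sW sq).
by rewrite mulrC; apply: (submodM sq).
Qed.

Lemma krull_chain_contraction (W : set K) m : centered (star_primes star) W ->
  krull_chain W m -> chain_from0 (star_primes star) m.
Proof.
move=> [vW GW] [p [pp ltp]]; have [/subringP sW bW dW] := vW.
pose c i : set D := @FracField.tofrac D @^-1` p i.
have Gc i : (i <= m)%N -> star_primes star (c i).
  move=> le_i; have := pp i le_i => pi; have [[piW spi] pi1 hpi] := pi.
  apply: (star_primes_sub hstar GW); last first.
    by move=> a; apply: (nonunits_sub (conj sW dW) pi).
  split.
  - split=> //; split; first by rewrite /c /preimage /= tofrac0; case: spi.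
    move=> a x y _ px py; rewrite /c /preimage /= tofracD tofracM.
    by case: spi => _; apply => //; apply: bW; apply: base_tofrac.
  - by rewrite /c /preimage /= tofrac1.
  - move=> a b _ _; rewrite /c /preimage /= tofracM; apply: hpi;
      apply: bW; exact: base_tofrac.
have ltc i : (i < m)%N -> c i `<` c i.+1.
  by move=> lt_i; apply: (contraction_strict vW (pp i (ltnW lt_i)) (pp i.+1 lt_i));
    [apply: ltp|apply: Gc].
(* The smallest contraction need not be zero; replacing it by the zero ideal keeps the length and
   strictness. *)
exists (fun i => if i is 0%N then [set 0] else c i); split=> //.
  by case=> [_|i /Gc //]; apply: star_primes0.
case=> [|i] lt_i; last exact: ltc.
have [sub nsub] := ltc 0%N lt_i; have [[_ [c00 _]] _ _] := (Gc 0%N isT).1.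
split=> [_ ->|h]; first exact: sub.
by apply: nsub; apply: (subset_trans h) => _ ->.
Qed.

End BaseStep.

(** * Adjoining several variables *)

Section Iteration.
Variable D : idomainType.
Variable star : set {fraction D} -> set {fraction D}.
Hypothesis hstar : semistar star.

Lemma star_iter_finite_type r :
  primes_of_finite_type (star_primes (star_iter star r)).
Proof.
elim: r => [|r IH]; first exact: star_primes_finite_type.
exact: star_primes_star_poly_finite_type.
Qed.

Lemma star_primes_iterS r :
  star_primes (star_iter star r.+1) = Theta (star_iter star r).
Proof. exact: star_primes_star_poly (@star_iter_finite_type r). Qed.

Lemma star_chain_iter r m : star_chain (star_iter star r.+1) m <->
  chain_from0 (star_primes (star_iter star r.+1)) m.
Proof.
apply: star_chainE; [by move=> P []|exact: star_primes0|].
rewrite star_primes_iterS; exact: QSpec_star_poly (@star_iter_finite_type r).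
Qed.

Lemma star_valuation_iter r V :
  star_valuation_overring (star_iter star r.+1) V <->
  centered (star_primes (star_iter star r.+1)) V.
Proof.
rewrite star_primes_iterS.
exact: star_valuation_star_poly (@star_iter_finite_type r) V.
Qed.

Lemma star_chain_tilde m :
  star_chain (star_tilde star) m <-> chain_from0 (star_primes star) m.
Proof.
apply: star_chainE; [by move=> P []|exact: star_primes0|].
exact: QSpec_star_tilde.
Qed.

Lemma chain_from0_iter r m : chain_from0 (star_primes star) m ->
  chain_from0 (star_primes (star_iter star r)) (r + m).
Proof.
move=> h; elim: r => [//|r [P [GP P0 ltP]]].
rewrite star_primes_iterS addSn.
exact: star_primes_chain_poly GP P0 ltP.
Qed.

Lemma krull_chain_iter r m (V : set {fraction (poly_iter D r)}) :
  centered (star_primes (star_iter star r)) V -> krull_chain V (r + m) ->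
  exists2 W : set {fraction D}, centered (star_primes star) W & krull_chain W m.
Proof.
elim: r V => [|r IH] V; first by exists V.
rewrite star_primes_iterS addSn => -[vV tV] cV.
apply: (IH (@frac_polyC (poly_iter D r) @^-1` V)); last exact: krull_chain_frac_poly.
split; first exact: valuation_overring_frac_poly.
have [_ h] := (ThetaE _ _).1 tV.
by rewrite center_frac_poly.
Qed.

End Iteration.

(** * Suprema of sets of natural numbers *)

Section Suprema.
Implicit Types A : set nat.

Lemma le_nat_bar k m : (nat_bar k <= nat_bar m)%O = (k <= m)%N.
Proof. by rewrite /nat_bar lee_fin lez_nat. Qed.

Lemma sup_nat_max A m : A m -> (forall k, A k -> (k <= m)%N) ->
  sup_nat A = nat_bar m.
Proof.
move=> Am hA; rewrite /sup_nat /supremum ifF; last first.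
  by apply/negbTE/set0P; exists (nat_bar m); exists m.
apply: xget_subset1; last exact: is_subset1_supremums.
split=> [_ [k Ak <-]|y]; first by rewrite le_nat_bar hA.
by apply; exists m.
Qed.

Lemma sup_nat_unbounded A : (forall m, exists2 k, A k & (m <= k)%N) ->
  sup_nat A = +oo%E.
Proof.
move=> hA; rewrite /sup_nat /supremum ifF; last first.
  by have [k Ak _] := hA 0%N; apply/negbTE/set0P; exists (nat_bar k); exists k.
apply: xget_subset1; last exact: is_subset1_supremums.
split=> [y _|[z||] // h]; first exact: leey.
  have [k Ak le_k] := hA `|z|.+1%N.
  have := h (nat_bar k) (ex_intro2 _ _ k Ak erefl).
  rewrite /nat_bar lee_fin => le_kz; exfalso.
  by lia.
by have [k Ak _] := hA 0%N; have := h (nat_bar k) (ex_intro2 _ _ k Ak erefl).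
Qed.

Lemma nat_max_or_unbounded A : A !=set0 ->
  (exists2 m, A m & forall k, A k -> (k <= m)%N) \/
  (forall m, exists2 k, A k & (m <= k)%N).
Proof.
move=> [a Aa]; have [ub|nub] := pselect (forall m, exists2 k, A k & (m <= k)%N).
  by right.
left; have [b hb] : exists b, forall k, A k -> (k <= b)%N.
  apply: contrapT => h; apply: nub => m; apply: contrapT => h'; apply: h.
  exists m => k Ak; rewrite leqNgt; apply/negP => lt_mk; apply: h'.
  by exists k => //; apply: ltnW.
have ex : exists k, `[< A k >] by exists a; apply/asboolP.
have ub k : `[< A k >] -> (k <= b)%N by move/asboolP/hb.
case: (ex_maxnP ex ub) => m /asboolP Am hm.
by exists m => // k Ak; apply: hm; apply/asboolP.
Qed.

Lemma sup_nat_le A m : (forall k, A k -> (k <= m)%N) -> (sup_nat A <= nat_bar m)%O.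
Proof.
(* The supremum of the empty set is the default value 0. *)
move=> hA; have [->|/set0P A0] := eqVneq A set0.
  by rewrite /sup_nat image_set0 supremum0 /nat_bar lee_fin.
have [[k Ak hk]|ub] := nat_max_or_unbounded A0.
  by rewrite (sup_nat_max Ak hk) le_nat_bar hA.
by have [k /hA le_k lt_k] := ub m.+1; move: (leq_trans lt_k le_k); rewrite ltnn.
Qed.

Lemma sup_nat_ge A m k : A k -> (sup_nat A <= nat_bar m)%O -> (k <= m)%N.
Proof.
move=> Ak; have [|[j Aj hj]|ub] := @nat_max_or_unbounded A; first by exists k.
  by rewrite (sup_nat_max Aj hj) le_nat_bar; apply: leq_trans; apply: hj.
by rewrite (sup_nat_unbounded ub).
Qed.

End Suprema.

Theorem corollary4p11 (D : idomainType)
    (star : set {fraction D} -> set {fraction D})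
    (hstar : semistar star) (n : nat) (hn : (1 <= n)%N) :
  (PsMD star -> quasi_prufer (star_tilde star)) /\
  (quasi_prufer (star_tilde star) ->
     star_dim (star_iter star n) = star_dimv (star_iter star n) /\
     star_dimv (star_iter star n) =
       (nat_bar n + star_dim (star_tilde star))%E).
Proof.
split; first exact: PsMD_quasi_prufer.
(* Here [n >= 1] enters: the descriptions of quasi-primes and valuation overrings concern operations
   of the form [star_poly]. *)
move=> qP; case: n hn => // n _.
pose st := star_iter star n.+1.
have lower m : star_chain (star_tilde star) m -> star_chain st (n.+1 + m).
  by move=> /(star_chain_tilde hstar)/(chain_from0_iter hstar n.+1)/(star_chain_iter hstar).
have lift k : star_chain st k ->
    exists2 V, star_valuation_overring st V & krull_chain V k.
  move=> /(star_chain_iter hstar) /chain_from0_valuation [P []//|V cV kV].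
  by exists V => //; apply/(star_valuation_iter hstar).
have upper V k : star_valuation_overring st V -> krull_chain V (n.+1 + k) ->
    star_chain (star_tilde star) k.
  move=> /(star_valuation_iter hstar) cV /(krull_chain_iter hstar cV) [W cW kW].
  by apply/(star_chain_tilde hstar); apply: krull_chain_contraction cW kW.
have c0 : star_chain (star_tilde star) 0 by exists (fun=> [set 0]).
have [[d cd hd]|ub] := @nat_max_or_unbounded (star_chain (star_tilde star)) (ex_intro _ _ c0).
  have bound V k : star_valuation_overring st V -> krull_chain V k -> (k <= n.+1 + d)%N.
    (* Only a chain longer than the number of variables leaves a remainder to contract to [D]. *)
    move=> sV kV; have [le_k|lt_k] := leqP k n.+1.
      exact: leq_trans le_k (leq_addr _ _).
    rewrite -(subnKC (ltnW lt_k)) leq_add2l; apply: hd; apply: (upper V) => //.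
    by rewrite subnKC // ltnW.
  have dimst : star_dim st = nat_bar (n.+1 + d).
    apply: sup_nat_max (lower _ cd) _ => k /lift [V sV kV]; exact: bound kV.
  have isd : is_star_dimv st (n.+1 + d).
    split=> [V sV|]; first by apply: sup_nat_le => k; apply: bound.
    have [V sV kV] := lift _ (lower _ cd); exists V => //.
    by apply: sup_nat_max kV _ => k; apply: bound.
  have dimvst : star_dimv st = nat_bar (n.+1 + d).
    apply: xget_unique; first by exists (n.+1 + d)%N.
    move=> _ [m [hm [V sV eV]] <-]; apply/eqP; rewrite eq_le; apply/andP; split.
      by rewrite -eV; apply: isd.1.
    by have [V' sV' <-] := isd.2; apply: hm.
  rewrite -/st dimst dimvst /star_dim (sup_nat_max cd hd); split=> //.
have dimst : star_dim st = +oo%E.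
  apply: sup_nat_unbounded => m; have [k ck le_k] := ub m.
  by exists (n.+1 + k)%N; [apply: lower|apply: leq_trans le_k (leq_addl _ _)].
have dimvst : star_dimv st = +oo%E.
  (* No integer m qualifies, because a chain longer than m lifts to a valuation overring; the
     default value is the right one. *)
  apply: xgetPN => _ [m [hm _] _]; have [k ck lt_k] := ub m.+1.
  have [V sV kV] := lift _ (lower _ ck).
  have := sup_nat_ge kV (hm V sV); lia.
by rewrite -/st dimst dimvst /star_dim (sup_nat_unbounded ub).
Qed.
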